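(* Let $R$ be a quasi-fiber product ring with $\dim R\le 3$. Let $M$ and $N$ be nonzero finitely generated $R$-modules such that $N$ is Tor-rigid, $\operatorname{Ext}^1_R(M,N)=0$, and $\operatorname{pd}_R N=\infty$. Then $M^*$ is free.
   Context: All local rings are commutative and Noetherian, and all modules are finitely generated. $M^*:=\operatorname{Hom}_R(M,R)$; $\operatorname{pd}$ denotes projective dimension. A local ring $(R,\mathfrak m,k)$ is a fiber product ring if $R\cong S\times_k T=\{(s,t)\in S\times T : \pi_S(s)=\pi_T(t)\}$, where $S,T$ are local rings with the same residue field $k$, neither of them equal to $k$, and $\pi_S,\pi_T$ are the reductions modulo the maximal ideals. Equivalently, $\mathfrak m=I\oplus J$ for nonzero ideals $I,J$ of $R$. A local ring $R$ is a quasi-fiber product ring if there is an $R$-regular sequence $\underline x=x_1,\dots,x_n$ with $n\ge 0$ such that $R/(\underline x)$ is a fiber product ring. An $R$-module $N$ is Tor-rigid if for every $R$-module $Z$ and every $n\ge 1$, $\operatorname{Tor}^R_n(N,Z)=0$ implies $\operatorname{Tor}^R_{n+1}(N,Z)=0$. *)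

(* Defs.v *)
From HB Require Import structures.
From mathcomp Require Import all_boot all_order all_algebra.
From mathcomp Require Import boolp.

Set Implicit Arguments.
Unset Strict Implicit.
Unset Printing Implicit Defensive.

Import GRing.Theory.
Local Open Scope ring_scope.
Local Open Scope quotient_scope.

Definition onto (A B : Type) (f : A -> B) : Prop := forall b, exists a, f a = b.

(** * Commutative rings *)

(* The ideal (s) generated by a finite sequence s. *)
Definition ideal_gen (R : comNzRingType) (s : seq R) (x : R) : Prop :=
  exists c : 'I_(size s) -> R, x = \sum_i c i * s`_i.

(* Ideals are the submodules of R^o; the library structure [idealr R], used
   below, only covers proper ideals. *)
Definition noetherian (R : comNzRingType) : Prop :=
  forall I : {pred R^o}, submod_closed I ->
    exists s : seq R, forall x : R, x \in I <-> ideal_gen s x.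

Definition maximal_ideal (R : comNzRingType) (I : idealr R) : Prop :=
  forall J : idealr R, {subset I <= J} -> {subset J <= I}.

(* Local rings are Noetherian by convention. *)
Definition local_ring (R : comNzRingType) : Prop :=
  noetherian R /\
  exists2 m : idealr R, maximal_ideal m &
    forall I : idealr R, maximal_ideal I -> I =i m.

(* dim R <= d: a strict chain p_0 < ... < p_n of primes has n <= d. *)
Definition krull_dim_le (R : comNzRingType) (d : nat) : Prop :=
  forall (n : nat) (p : nat -> prime_idealr R),
    (forall i, (i < n)%N ->
       {subset p i <= p i.+1} /\ ~ {subset p i.+1 <= p i}) ->
    (n <= d)%N.

(* xs_i is a nonzerodivisor on R/(xs_0, ..., xs_(i-1)) for every i, and
   R/(xs) is not zero. *)
Definition regular_sequence (R : comNzRingType) (xs : seq R) : Prop :=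
  (forall i, (i < size xs)%N -> forall r : R,
     ideal_gen (take i xs) (xs`_i * r) -> ideal_gen (take i xs) r) /\
  ~ ideal_gen xs 1.

Section FiberProduct.
Variables (k S T : comNzRingType).
Variables (piS : {rmorphism S -> k}) (piT : {rmorphism T -> k}).

Definition fiber_pred : {pred S * T} := [pred x | piS x.1 == piT x.2].

Lemma fiber_pred_subring : subring_closed fiber_pred.
Proof.
split=> [|x y|x y]; rewrite !inE /= ?rmorph1 //.
  by rewrite !rmorphB => /eqP-> /eqP->.
by rewrite !rmorphM => /eqP-> /eqP->.
Qed.

HB.instance Definition _ :=
  GRing.isSubringClosed.Build (S * T)%type fiber_pred fiber_pred_subring.

Record fiber_product := FiberProduct {
  fiber_val :> S * T;
  fiber_valP : fiber_val \in fiber_pred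
}.

HB.instance Definition _ := [isSub for fiber_val].
HB.instance Definition _ := [Choice of fiber_product by <:].
HB.instance Definition _ := [SubChoice_isSubComNzRing of fiber_product by <:].

End FiberProduct.

(* A surjection from a local ring onto a field k has the maximal ideal as its
   kernel, i.e. it is the reduction onto the residue field; it fails to be
   injective exactly when the local ring is not equal to k. *)
Definition is_fiber_product_of (R k S T : comNzRingType)
    (piS : {rmorphism S -> k}) (piT : {rmorphism T -> k}) : Prop :=
  [/\ local_ring S /\ local_ring T,
      onto piS /\ onto piT,
      ~ injective piS /\ ~ injective piT &
      exists f : {rmorphism R -> fiber_product piS piT}, bijective f].

Definition fiber_product_ring (R : comNzRingType) : Prop :=
  local_ring R /\
  exists (k : fieldType) (S T : comNzRingType)
    (piS : {rmorphism S -> k}) (piT : {rmorphism T -> k}),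
    is_fiber_product_of R piS piT.

Definition quasi_fiber_product_ring (R : comNzRingType) : Prop :=
  local_ring R /\
  exists (xs : seq R) (I : idealr R),
    [/\ regular_sequence xs,
        forall x : R, x \in I <-> ideal_gen xs x &
        fiber_product_ring {ideal_quot I}].

(** * Modules *)

Definition fg_module (R : comNzRingType) (M : lmodType R) : Prop :=
  exists (n : nat) (g : 'I_n -> M),
    forall x : M, exists c : 'I_n -> R, x = \sum_i c i *: g i.

(* Free of finite rank; the rank may be 0. *)
Definition free_module (R : comNzRingType) (M : lmodType R) : Prop :=
  exists (n : nat) (f : {linear 'rV[R]_n -> M}), bijective f.

Definition projective (R : comNzRingType) (P : lmodType R) : Prop :=
  forall (A B : lmodType R) (f : {linear A -> B}) (g : {linear P -> B}),
    onto f -> exists h : {linear P -> A}, forall x, f (h x) = g x.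

(** ** Hom *)

Section Hom.
Variables (R : comNzRingType) (M N : lmodType R).

Definition hom : Type := {linear M -> N}.

HB.instance Definition _ := gen_eqMixin hom.
HB.instance Definition _ := gen_choiceMixin hom.

Implicit Types f g h : hom.

Lemma hom_eq f g : (forall x, f x = g x) -> f = g.
Proof.
case: f g => [f [[fD] [fZ]]] [g [[gD] [gZ]]] /= /funext fg.
case: _ / fg in gD gZ *; congr GRing.Linear.Pack.
by congr GRing.Linear.Class; congr (_ _); exact: Prop_irrelevance.
Qed.

Definition hom_zero : hom := (\0 : M -> N).
Definition hom_opp f : hom := (\- f : M -> N).
Definition hom_add f g : hom := (f \+ g : M -> N).
Definition hom_scale (a : R) f : hom := (a \*: f : M -> N).

Lemma hom_addA : associative hom_add.
Proof. by move=> f g h; apply: hom_eq => x; exact: addrA. Qed.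
Lemma hom_addC : commutative hom_add.
Proof. by move=> f g; apply: hom_eq => x; exact: addrC. Qed.
Lemma hom_add0 : left_id hom_zero hom_add.
Proof. by move=> f; apply: hom_eq => x; exact: add0r. Qed.
Lemma hom_addN : left_inverse hom_zero hom_opp hom_add.
Proof. by move=> f; apply: hom_eq => x; exact: addNr. Qed.

HB.instance Definition _ :=
  GRing.isZmodule.Build hom hom_addA hom_addC hom_add0 hom_addN.

Lemma hom_scaleA a b f : hom_scale a (hom_scale b f) = hom_scale (a * b) f.
Proof. by apply: hom_eq => x; exact: scalerA. Qed.
Lemma hom_scale1 : left_id 1 hom_scale.
Proof. by move=> f; apply: hom_eq => x; exact: scale1r. Qed.
Lemma hom_scaleDr : right_distributive hom_scale +%R.
Proof. by move=> a f g; apply: hom_eq => x; exact: scalerDr. Qed.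
Lemma hom_scaleDl f : {morph hom_scale^~ f : a b / a + b}.
Proof. by move=> a b; apply: hom_eq => x; exact: scalerDl. Qed.

HB.instance Definition _ := GRing.Zmodule_isLmodule.Build R hom
  hom_scaleA hom_scale1 hom_scaleDr hom_scaleDl.

End Hom.

Definition dual (R : comNzRingType) (M : lmodType R) : lmodType R :=
  hom M R^o.

Section HomPre.
Variables (R : comNzRingType) (M M' : lmodType R) (d : {linear M -> M'}).
Variable N : lmodType R.

Definition hom_pre (f : hom M' N) : hom M N := (f : {linear _ -> _}) \o d.

Lemma hom_pre_linear : linear hom_pre.
Proof. by move=> a f g; apply: hom_eq. Qed.

HB.instance Definition _ :=
  GRing.isLinear.Build R (hom M' N) (hom M N) *:%R hom_pre hom_pre_linear.

End HomPre.

(** ** Tensor product *)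

(* A sequence of pairs (x, y) stands for the sum of the x (x) y, and M (x) N is
   the quotient by the congruence generated by the bilinearity relations. *)
Section Tensor.
Variables (R : comNzRingType) (M N : lmodType R).
Implicit Types s : seq (M * N).

Inductive tensor_rel : seq (M * N) -> seq (M * N) -> Prop :=
| TRrefl s : tensor_rel s s
| TRsym s t : tensor_rel s t -> tensor_rel t s
| TRtrans s t u : tensor_rel s t -> tensor_rel t u -> tensor_rel s u
| TRcat s t u v : tensor_rel s t -> tensor_rel u v ->
    tensor_rel (s ++ u) (t ++ v)
| TRcatC s t : tensor_rel (s ++ t) (t ++ s)
| TR0l (y : N) : tensor_rel [:: (0, y)] [::]
| TRDl (x x' : M) (y : N) : tensor_rel [:: (x + x', y)] [:: (x, y); (x', y)]
| TRDr (x : M) (y y' : N) : tensor_rel [:: (x, y + y')] [:: (x, y); (x, y')]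
| TRZ (a : R) (x : M) (y : N) : tensor_rel [:: (a *: x, y)] [:: (x, a *: y)].

Definition tensor_relb s (t : seq (M * N)) : bool := `[< tensor_rel s t >].

Lemma tensor_relb_equiv : equiv_class_of tensor_relb.
Proof.
split=> [s|s t|t s u]; first by apply/asboolP; exact: TRrefl.
  by apply/asboolP/asboolP => /TRsym.
by move=> /asboolP st /asboolP tu; apply/asboolP; exact: TRtrans st tu.
Qed.

Canonical tensor_equiv := EquivRelPack tensor_relb_equiv.
Canonical tensor_encModRel := defaultEncModRel tensor_relb.

Definition tensor : Type := {eq_quot tensor_relb}.
HB.instance Definition _ : EqQuotient _ tensor_relb tensor :=
  EqQuotient.on tensor.
HB.instance Definition _ := Choice.on tensor.

Definition tsum (s : seq (M * N)) : tensor := \pi_tensor s.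

Lemma tsumP s t : tsum s = tsum t <-> tensor_rel s t.
Proof. by split=> [/eqquotP /asboolP|st] //; apply/eqquotP/asboolP. Qed.

Lemma tsum_repr (t : tensor) : tsum (repr t) = t.
Proof. exact: reprK. Qed.

Lemma tensor_rel_repr s : tensor_rel (repr (tsum s)) s.
Proof. by apply/tsumP; rewrite tsum_repr. Qed.

Definition scale_pairs (a : R) s : seq (M * N) :=
  [seq (a *: p.1, p.2) | p <- s].

Lemma tensor_rel_scale a s t :
  tensor_rel s t -> tensor_rel (scale_pairs a s) (scale_pairs a t).
Proof.
elim=> {s t} /= [s|s t _|s t u _ st _|s t u v _ st _ uv|s t|y|x x' y|x y y'|b x y].
- exact: TRrefl.
- exact: TRsym.
- exact: TRtrans st.
- by rewrite /scale_pairs !map_cat; exact: TRcat.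
- by rewrite /scale_pairs !map_cat; exact: TRcatC.
- by rewrite scaler0; exact: TR0l.
- by rewrite scalerDr; exact: TRDl.
- exact: TRDr.
- by rewrite scalerA mulrC -scalerA; exact: TRZ.
Qed.

Lemma tensor_rel_scaleD a b s :
  tensor_rel (scale_pairs (a + b) s) (scale_pairs a s ++ scale_pairs b s).
Proof.
elim: s => [|[x y] s IHs] /=; first exact: TRrefl.
rewrite scalerDl.
apply: TRtrans (TRcat (TRDl (a *: x) (b *: x) y) IHs) _.
rewrite -[_ :: _ ++ _]/([:: (a *: x, y)] ++ (scale_pairs a s ++
  ([:: (b *: x, y)] ++ scale_pairs b s))).
rewrite -[_ ++ (_ ++ _)]/([:: (a *: x, y)] ++
  ([:: (b *: x, y)] ++ (scale_pairs a s ++ scale_pairs b s))).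
apply: TRcat (TRrefl _) _; rewrite !catA.
by apply: TRcat (TRcatC _ _) (TRrefl _).
Qed.

Lemma tensor_rel_scale0 s : tensor_rel (scale_pairs 0 s) [::].
Proof.
elim: s => [|[x y] s IHs] /=; first exact: TRrefl.
by rewrite scale0r; exact: (TRcat (TR0l y) IHs).
Qed.

Definition tensor_scale (a : R) (t : tensor) : tensor :=
  tsum (scale_pairs a (repr t)).
Definition tensor_zero : tensor := tsum [::].
Definition tensor_add (t u : tensor) : tensor := tsum (repr t ++ repr u).
Definition tensor_opp : tensor -> tensor := tensor_scale (- 1).

Lemma tensor_scaleE a s : tensor_scale a (tsum s) = tsum (scale_pairs a s).
Proof. by apply/tsumP/tensor_rel_scale/tensor_rel_repr. Qed.

Lemma tensor_addE s t : tensor_add (tsum s) (tsum t) = tsum (s ++ t).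
Proof. by apply/tsumP/TRcat; exact: tensor_rel_repr. Qed.

Lemma tensor_addA : associative tensor_add.
Proof.
move=> t u v; rewrite -(tsum_repr t) -(tsum_repr u) -(tsum_repr v).
by rewrite !tensor_addE catA.
Qed.

Lemma tensor_addC : commutative tensor_add.
Proof.
move=> t u; rewrite -(tsum_repr t) -(tsum_repr u) !tensor_addE.
by apply/tsumP; exact: TRcatC.
Qed.

Lemma tensor_add0 : left_id tensor_zero tensor_add.
Proof. by move=> t; rewrite -(tsum_repr t) tensor_addE. Qed.

Lemma tensor_scaleA a b t :
  tensor_scale a (tensor_scale b t) = tensor_scale (a * b) t.
Proof.
rewrite -(tsum_repr t) !tensor_scaleE /scale_pairs -map_comp.
by congr tsum; apply: eq_map => p /=; rewrite scalerA.
Qed.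

Lemma tensor_scale1 : left_id 1 tensor_scale.
Proof.
move=> t; rewrite -(tsum_repr t) tensor_scaleE; congr tsum.
by rewrite -[RHS]map_id; apply: eq_map => -[x y] /=; rewrite scale1r.
Qed.

Lemma tensor_scaleDr : right_distributive tensor_scale tensor_add.
Proof.
move=> a t u; rewrite -(tsum_repr t) -(tsum_repr u).
by rewrite !(tensor_addE, tensor_scaleE) /scale_pairs map_cat.
Qed.

Lemma tensor_scaleDl t a b :
  tensor_scale (a + b) t = tensor_add (tensor_scale a t) (tensor_scale b t).
Proof.
rewrite -(tsum_repr t) !(tensor_addE, tensor_scaleE).
by apply/tsumP; exact: tensor_rel_scaleD.
Qed.

Lemma tensor_addN : left_inverse tensor_zero tensor_opp tensor_add.
Proof.
move=> t; rewrite -{2}(tensor_scale1 t) -tensor_scaleDl addNr -(tsum_repr t).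
by rewrite tensor_scaleE; apply/tsumP; exact: tensor_rel_scale0.
Qed.

HB.instance Definition _ := GRing.isZmodule.Build tensor
  tensor_addA tensor_addC tensor_add0 tensor_addN.
HB.instance Definition _ := GRing.Zmodule_isLmodule.Build R tensor
  tensor_scaleA tensor_scale1 tensor_scaleDr tensor_scaleDl.

End Tensor.

Section TensorMap.
Variables (R : comNzRingType) (M M' : lmodType R) (d : {linear M -> M'}).
Variable N : lmodType R.

Definition map_pairs (s : seq (M * N)) : seq (M' * N) :=
  [seq (d p.1, p.2) | p <- s].

Definition tensor_map (t : tensor M N) : tensor M' N :=
  tsum (map_pairs (repr t)).

Lemma tensor_rel_map s t :
  tensor_rel s t -> tensor_rel (map_pairs s) (map_pairs t).
Proof.
elim=> {s t} /= [s|s t _|s t u _ st _|s t u v _ st _ uv|s t|y|x x' y|x y y'|b x y].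
- exact: TRrefl.
- exact: TRsym.
- exact: TRtrans st.
- by rewrite /map_pairs !map_cat; exact: TRcat.
- by rewrite /map_pairs !map_cat; exact: TRcatC.
- by rewrite linear0; exact: TR0l.
- by rewrite linearD; exact: TRDl.
- exact: TRDr.
- by rewrite linearZ; exact: TRZ.
Qed.

Lemma tensor_mapE s : tensor_map (tsum s) = tsum (map_pairs s).
Proof. by apply/tsumP/tensor_rel_map/tensor_rel_repr. Qed.

Lemma tensor_map_linear : linear tensor_map.
Proof.
move=> a t u; rewrite -(tsum_repr t) -(tsum_repr u).
have addE K s s' : tsum s + tsum s' = tsum (s ++ s') :> tensor K N.
  exact: tensor_addE.
have scaleE K s : a *: tsum s = tsum (scale_pairs a s) :> tensor K N.
  exact: tensor_scaleE.
rewrite scaleE addE !tensor_mapE scaleE addE.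
rewrite /map_pairs map_cat /scale_pairs -!map_comp.
by congr (tsum (_ ++ _)); apply: eq_map => p /=; rewrite linearZ.
Qed.

HB.instance Definition _ := GRing.isLinear.Build R
  (tensor M N) (tensor M' N) *:%R tensor_map tensor_map_linear.

End TensorMap.

(* The universal property: the pure tensors x (x) y are bilinear, and every
   bilinear map factors uniquely through them. *)
Section TensorUniversal.
Variables (R : comNzRingType) (M N : lmodType R).

Definition pure (x : M) (y : N) : tensor M N := tsum [:: (x, y)].

Lemma pure_linearl y : linear (pure^~ y).
Proof.
move=> a x x'; apply: esym; rewrite [a *: _]tensor_scaleE [LHS]tensor_addE.
by apply/tsumP/TRsym; exact: TRDl.
Qed.

Lemma pure_linearr x : linear (pure x).
Proof.
move=> a y y'; apply: esym; rewrite [a *: _]tensor_scaleE [LHS]tensor_addE.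
apply/tsumP/TRsym/(TRtrans (TRDr _ _ _)).
exact: (TRcat (TRsym (TRZ a x y)) (TRrefl [:: (x, y')])).
Qed.

Lemma tensor_universal (P : lmodType R) (b : M -> N -> P) :
  (forall y, linear (b^~ y)) -> (forall x, linear (b x)) ->
  exists! f : hom (tensor M N) P, forall x y, f (pure x y) = b x y.
Proof.
move=> bl br.
have bDl x x' y : b (x + x') y = b x y + b x' y.
  by have := bl y 1 x x'; rewrite !scale1r.
have bDr x y y' : b x (y + y') = b x y + b x y'.
  by have := br x 1 y y'; rewrite !scale1r.
have b0l y : b 0 y = 0.
  by apply: (addrI (b 0 y)); rewrite -bDl !addr0.
have b0r x : b x 0 = 0.
  by apply: (addrI (b x 0)); rewrite -bDr !addr0.
have bZl a x y : b (a *: x) y = a *: b x y.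
  by have := bl y a x 0; rewrite b0l !addr0.
have bZr a x y : b x (a *: y) = a *: b x y.
  by have := br x a y 0; rewrite b0r !addr0.
pose F (s : seq (M * N)) := \sum_(p <- s) b p.1 p.2.
have FP s t : tensor_rel s t -> F s = F t.
  elim=> {s t} //= [s t u _ -> _ //|s t u v _ st _ uv|s t|y|x x' y|x y y'|a x y].
  - by rewrite /F !big_cat /=; congr (_ + _).
  - by rewrite /F !big_cat /= addrC.
  - by rewrite /F big_seq1 big_nil b0l.
  - by rewrite /F !big_cons big_nil !addr0 bDl.
  - by rewrite /F !big_cons big_nil !addr0 bDr.
  - by rewrite /F !big_seq1 /= bZl bZr.
pose f (t : tensor M N) := F (repr t).
have fE s : f (tsum s) = F s by apply: FP; exact: tensor_rel_repr.
have f_lin : linear f.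
  move=> a t u; rewrite -(tsum_repr t) -(tsum_repr u).
  rewrite [a *: _]tensor_scaleE [tsum _ + _]tensor_addE !fE /F big_cat /=.
  rewrite /scale_pairs big_map scaler_sumr; congr (_ + _).
  by apply: eq_bigr => p _; rewrite bZl.
pose fL := GRing.isLinear.Build R (tensor M N) P *:%R f f_lin.
pose g : hom (tensor M N) P := HB.pack f fL.
exists g; split=> [x y|h hE]; first by rewrite /g /= fE /F big_seq1.
apply: hom_eq => t; rewrite -(tsum_repr t) /= fE.
elim: (repr t) => [|[x y] s IHs].
  by rewrite /F big_nil; apply: esym; exact: (linear0 (h : {linear _ -> _})).
rewrite -(tensor_addE [:: (x, y)] s) /F big_cons -/(F s) IHs -hE.
by apply: esym; exact: (linearD (h : {linear _ -> _})).
Qed.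

End TensorUniversal.

(** ** Resolutions, Tor, Ext and projective dimension *)

Record proj_resolution (R : comNzRingType) (M : lmodType R) := ProjResolution {
  res_obj :> nat -> lmodType R;
  res_diff : forall n, {linear res_obj n.+1 -> res_obj n};
  res_aug : {linear res_obj 0%N -> M};
  res_projective : forall n, projective (res_obj n);
  res_aug_onto : onto res_aug;
  res_exact0 : forall x, res_aug x = 0 <-> exists y, res_diff 0%N y = x;
  res_exactS : forall n x,
    res_diff n x = 0 <-> exists y, res_diff n.+1 y = x
}.

(* H_n(C) = 0, for a chain complex ... -> C 1 -> C 0 -> 0. *)
Definition homology_zero (R : comNzRingType) (C : nat -> lmodType R)
    (d : forall n, {linear C n.+1 -> C n}) (n : nat) : Prop :=
  match n with
  | 0%N => onto (d 0%N)
  | m.+1 => forall x, d m x = 0 -> exists y, d m.+1 y = x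
  end.

(* H^n(C) = 0, for a cochain complex 0 -> C 0 -> C 1 -> ... *)
Definition cohomology_zero (R : comNzRingType) (C : nat -> lmodType R)
    (d : forall n, {linear C n -> C n.+1}) (n : nat) : Prop :=
  match n with
  | 0%N => forall x, d 0%N x = 0 -> x = 0
  | m.+1 => forall x, d m.+1 x = 0 -> exists y, d m y = x
  end.

(* Tor and Ext do not depend on the projective resolution of the first
   argument, so the vanishing conditions may be tested on any one of them. *)
Definition Tor_zero (R : comNzRingType) (n : nat) (M N : lmodType R) : Prop :=
  exists P : proj_resolution M,
    @homology_zero R (fun i => tensor (P i) N)
      (fun i => tensor_map (res_diff P i) (N := N)) n.

Definition Ext_zero (R : comNzRingType) (n : nat) (M N : lmodType R) : Prop :=
  exists P : proj_resolution M,
    @cohomology_zero R (fun i => hom (P i) N)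
      (fun i => hom_pre (res_diff P i) (N := N)) n.

Definition pd_le (R : comNzRingType) (M : lmodType R) (n : nat) : Prop :=
  exists P : proj_resolution M, forall i, (n < i)%N -> forall x : P i, x = 0.

Definition pd_infinite (R : comNzRingType) (M : lmodType R) : Prop :=
  forall n, ~ pd_le M n.

(* Modules are finitely generated by convention, so Z is too. *)
Definition Tor_rigid (R : comNzRingType) (N : lmodType R) : Prop :=
  forall Z : lmodType R, fg_module Z ->
  forall n, (1 <= n)%N -> Tor_zero n N Z -> Tor_zero n.+1 N Z.

(* Main.v *)
Require Import Defs.
From HB Require Import structures.
From mathcomp Require Import all_boot all_order all_algebra.
From mathcomp Require Import boolp.
From mathcomp Require classical_sets.
From mathcomp Require Import ring.

Set Implicit Arguments.
Unset Strict Implicit.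
Unset Printing Implicit Defensive.

Import GRing.Theory.
Local Open Scope ring_scope.
Local Open Scope quotient_scope.

(* Let x be the regular sequence, n its length, A = R/(x), and let
   F_2 -> F_1 -> F_0 -> M -> 0 be a minimal presentation.  Put
   X := coker (F_1^* -> F_2^* ).  Ext^1(M, N) = 0 gives Tor_1(N, X) = 0, hence by
   rigidity Tor_i(N, X) = 0 for all i >= 1; the vanishing of Tor_2 and Nakayama
   force Ext^1(M, R) = 0, so that M^* is the third syzygy of X.

   Reducing the resolutions D of N and E of X modulo x keeps them exact, and the
   Tor groups zero, in degrees > n.  Over A the maximal ideal is I + J with
   IJ = 0.  The second syzygy of a module lies in m F_1 = I F_1 + J F_1 and splits
   accordingly, so if it is nonzero it has a minimal generator with entries in I
   or in J.  If e maps to a minimal generator with entries in J and x in I is a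
   minimal generator of I, then x e is a minimal generator of the next syzygy,
   with entries in I.  So the types I and J alternate along a resolution.  If
   neither resolution stopped, one would find a minimal generator x e of a
   syzygy of N with x in I and a minimal generator v of a syzygy of X with
   entries in J; then (x e) (x) v maps to e (x) (x v) = 0, and it gives a nonzero
   element of some Tor.  As pd N is infinite, the resolution of X stops, soon
   enough for M^* to be free: if n = 3 = dim R, then A is Artinian, and one more
   step is gained because a nonzero element of A annihilates the maximal ideal
   entries of any given row. *)

(** * Complexes of free modules modulo an ideal *)

Section Submodules.
Variables (R : comNzRingType) (V : lmodType R).

Definition submodule (K : V -> Prop) : Prop :=
  K 0 /\ forall (c : R) u v, K u -> K v -> K (c *: u + v).

Variable K : V -> Prop.
Hypothesis subK : submodule K.

Lemma submod0 : K 0. Proof. by case: subK. Qed.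

Lemma submodZ c u : K u -> K (c *: u).
Proof. by move=> Ku; rewrite -[_ *: _]addr0; apply: subK.2 => //; exact: submod0. Qed.

Lemma submodD u v : K u -> K v -> K (u + v).
Proof. by move=> Ku Kv; rewrite -[u]scale1r; exact: subK.2. Qed.

Lemma submodN u : K u -> K (- u).
Proof. by rewrite -scaleN1r; exact: submodZ. Qed.

Lemma submodB u v : K u -> K v -> K (u - v).
Proof. by move=> Ku /submodN; exact: submodD. Qed.

Lemma submod_sum (T : finType) (f : T -> V) : (forall i, K (f i)) -> K (\sum_i f i).
Proof. by move=> Kf; elim/big_ind: _ => //; [exact: submod0 | exact: submodD]. Qed.

End Submodules.

Definition ideal (R : comNzRingType) (a : R -> Prop) : Prop :=
  @submodule R R^o a.

Lemma ideal_mull (R : comNzRingType) (a : R -> Prop) (c x : R) :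
  ideal a -> a x -> a (c * x).
Proof. by move=> ida ax; exact: (@submodZ _ R^o _ ida c x ax). Qed.

Lemma ideal_mulr (R : comNzRingType) (a : R -> Prop) (c x : R) :
  ideal a -> a x -> a (x * c).
Proof. by rewrite mulrC; exact: ideal_mull. Qed.

Lemma ideal_genP (R : comNzRingType) (s : seq R) : ideal (ideal_gen s).
Proof.
split; first by exists (fun=> 0); rewrite big1 // => i _; rewrite mul0r.
move=> c u v [f ->] [g ->]; exists (fun i => c * f i + g i).
rewrite [_ *: _]mulr_sumr -big_split; apply: eq_bigr => i _ /=.
by rewrite mulrDl mulrA.
Qed.

Lemma ideal_gen_nil (R : comNzRingType) (x : R) : ideal_gen [::] x -> x = 0.
Proof. by case=> c ->; rewrite big_ord0. Qed.

(** Coefficients indexed by [nat] keep their type when the sequence grows. *)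
Lemma ideal_genE (R : comNzRingType) (s : seq R) (r : R) :
  ideal_gen s r <-> exists c : nat -> R, r = \sum_(i < size s) c i * s`_i.
Proof.
split=> [[c ->]|[c ->]]; last by exists (fun i => c i).
exists (fun k => if insub k is Some i then c i else 0).
by apply: eq_bigr => i _; rewrite valK.
Qed.

Lemma ideal_gen_rcons (R : comNzRingType) (s : seq R) (x r : R) :
  ideal_gen (rcons s x) r <-> exists y, ideal_gen s (r - x * y).
Proof.
split=> [/ideal_genE[c ->]|[y /ideal_genE[c rE]]].
  exists (c (size s)); rewrite size_rcons big_ord_recr /=.
  rewrite nth_rcons ltnn eqxx mulrC addrK; apply/ideal_genE; exists c.
  by apply: eq_bigr => i _; rewrite nth_rcons ltn_ord.
apply/ideal_genE; exists (fun k => if (k < size s)%N then c k else y).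
rewrite size_rcons big_ord_recr /= nth_rcons !ltnn eqxx.
move: rE => /eqP; rewrite subr_eq mulrC => /eqP ->; congr (_ + _).
by apply: eq_bigr => i _; rewrite nth_rcons !ltn_ord.
Qed.

Section MatrixIn.
Variables (R : comNzRingType) (a : R -> Prop).

Definition mxin p q (A : 'M[R]_(p, q)) : Prop := forall i j, a (A i j).

Hypothesis ida : ideal a.

Lemma mxin_submod p q : submodule (@mxin p q).
Proof.
split=> [i j|c A B aA aB i j]; rewrite !mxE; first exact: (submod0 ida).
by apply: (submodD ida); [exact: ideal_mull | exact: aB].
Qed.

Lemma mxinMl p q r (B : 'M_(p, q)) (A : 'M_(q, r)) : mxin A -> mxin (B *m A).
Proof.
move=> aA i j; rewrite mxE; apply: (submod_sum ida) => k.
exact: ideal_mull.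
Qed.

Lemma mxinMr p q r (B : 'M_(q, r)) (A : 'M_(p, q)) : mxin A -> mxin (A *m B).
Proof.
move=> aA i j; rewrite mxE; apply: (submod_sum ida) => k.
exact: ideal_mulr.
Qed.

Lemma mxinZl p q (c : R) (A : 'M_(p, q)) : a c -> mxin (c *: A).
Proof. by move=> ac i j; rewrite mxE; exact: ideal_mulr. Qed.

End MatrixIn.

Lemma mxin_tr (R : comNzRingType) (a : R -> Prop) p q (A : 'M[R]_(p, q)) :
  mxin a A -> mxin a A^T.
Proof. by move=> aA i j; rewrite mxE. Qed.

Lemma mxin_choice (R : comNzRingType) (a : R -> Prop) (b : R -> R -> Prop)
    p q (A : 'M[R]_(p, q)) :
  (forall x, a x -> exists y, b x y) -> mxin a A ->
  exists Y : 'M_(p, q), forall i j, b (A i j) (Y i j).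
Proof.
move=> ab aA.
have /choice[f fP] (ij : 'I_p * 'I_q) : exists y, b (A ij.1 ij.2) y by exact: ab.
by exists (\matrix_(i, j) f (i, j)) => i j; rewrite mxE; exact: (fP (i, j)).
Qed.

(* Free chain complexes, differentials acting on row vectors on the right. *)
Record fcomplex (R : comNzRingType) := FComplex {
  rk : nat -> nat;
  df : forall i, 'M[R]_(rk i.+1, rk i);
  df_df : forall i, df i.+1 *m df i = 0
}.

Ltac mxring := rewrite ?(mulmxDl, mulmxBl, mulmxDr, mulmxBr, mulNmx, mulmxN,
  =^~ scalemxAl, =^~ scalemxAr, mulmxA); apply/matrixP => ? ?; rewrite !mxE; ring.

Section ExactMod.
Variables (R : comNzRingType) (a : R -> Prop).

(** Exactness of the reduced complex, written as congruences over [R] so that no quotient ring is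
    formed. Several rows are treated at once because the Tor conditions are about matrices. *)
Definition exact_mod (D : fcomplex R) (i : nat) : Prop :=
  forall p (x : 'M_(p, rk D i.+1)), mxin a (x *m df D i) ->
    exists y, mxin a (x - y *m df D i.+1).

(* Tor_(i+1)(N, coker E_j) = 0 modulo a, for D a resolution of N. *)
Definition tor_mod (D E : fcomplex R) (i j : nat) : Prop :=
  forall w v, mxin a ((df D i)^T *m w - v *m df E j) ->
    exists w' v', mxin a (w - (df D i.+1)^T *m w' - v' *m df E j).

Hypothesis ida : ideal a.

Lemma exact_mod_tr (D : fcomplex R) i : exact_mod D i ->
  forall p (x : 'M_(rk D i.+1, p)), mxin a ((df D i)^T *m x) ->
    exists y, mxin a (x - (df D i.+1)^T *m y).
Proof.
move=> exD p x /mxin_tr; rewrite trmx_mul trmxK => /exD[y /mxin_tr].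
by rewrite linearB /= trmxK trmx_mul => ay; exists y^T.
Qed.

(** Dimension shifting: by exactness of [E], the cokernel of [df E j.+1] is modulo [a] the syzygy of
    that of [df E j]. *)
Lemma tor_mod_shift (D E : fcomplex R) i j :
  exact_mod D i -> exact_mod E j -> tor_mod D E i.+1 j -> tor_mod D E i j.+1.
Proof.
move=> exD exE torDE w v wv.
have /(exact_mod_tr exD)[u wu] : mxin a ((df D i)^T *m (w *m df E j)).
  have -> : (df D i)^T *m (w *m df E j) =
      ((df D i)^T *m w - v *m df E j.+1) *m df E j.
    by rewrite mulmxBl -!mulmxA df_df mulmx0 subr0.
  exact: mxinMr.
have [|u' [u'' uE]] := torDE u w.
  by rewrite -opprB; apply: (submodN (mxin_submod ida _ _)).
have /exE[w' wE] : mxin a ((w - (df D i.+1)^T *m u'') *m df E j).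
  have -> : (w - (df D i.+1)^T *m u'') *m df E j =
      (w *m df E j - (df D i.+1)^T *m u) + (df D i.+1)^T *m
       (u - (df D i.+2)^T *m u' - u'' *m df E j).
    have dd : (df D i.+1)^T *m (df D i.+2)^T = 0.
      by rewrite -trmx_mul df_df trmx0.
    by rewrite !mulmxBr (mulmxA _ _ u') dd mul0mx; mxring.
  by apply: (submodD (mxin_submod ida _ _)) => //; exact: mxinMl.
by exists u'', w'.
Qed.

End ExactMod.

(** * Reduction modulo a regular sequence *)

Section RegularSequence.
Variables (R : comNzRingType) (xs : seq R).
Hypothesis regxs : regular_sequence xs.

Local Notation aa l := (ideal_gen (take l xs)).

Lemma ideal_gen_takeS l r : (l < size xs)%N ->
  aa l.+1 r <-> exists y, aa l (r - xs`_l * y).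
Proof. by move=> ls; rewrite (take_nth 0) // ideal_gen_rcons. Qed.

Lemma mxin_takeS l p q (A : 'M_(p, q)) : (l < size xs)%N ->
  mxin (aa l.+1) A -> exists Y, mxin (aa l) (A - xs`_l *: Y).
Proof.
move=> ls aA.
have [|Y YP] := mxin_choice (b := fun x y => aa l (x - xs`_l * y)) _ aA.
  by move=> x /ideal_gen_takeS; apply.
by exists Y => i j; rewrite !mxE; exact: YP.
Qed.

Lemma mxin_take_widen l p q (A Y : 'M_(p, q)) : (l < size xs)%N ->
  mxin (aa l) (A - xs`_l *: Y) -> mxin (aa l.+1) A.
Proof.
move=> ls aA i j; apply/ideal_gen_takeS => //; exists (Y i j).
by have := aA i j; rewrite !mxE.
Qed.

Lemma mxin_take_reg l p q (A : 'M_(p, q)) : (l < size xs)%N ->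
  mxin (aa l) (xs`_l *: A) -> mxin (aa l) A.
Proof.
move=> ls aA i j; apply: regxs.1 => //.
by have := aA i j; rewrite mxE.
Qed.

(** Each new regular element x_l costs one degree: if x d = x_l Y modulo [aa l], then Y is a cycle
    one degree lower because x_l is regular. With Y = W d, the row x - x_l W is a cycle modulo
    [aa l]. *)
Lemma exact_mod_regular (D : fcomplex R) : (forall i, exact_mod (aa 0) D i) ->
  forall l i, (l <= size xs)%N -> (l <= i)%N -> exact_mod (aa l) D i.
Proof.
move=> exD; elim=> [|l IHl] // [|i] // ls li p x /(mxin_takeS ls)[Y xY].
have ida := ideal_genP (take l xs).
have [|W YW] := IHl i (ltnW ls) li _ Y.
  apply: (mxin_take_reg ls).
  have -> : xs`_l *: (Y *m df D i) = - ((x *m df D i.+1 - xs`_l *: Y) *m df D i).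
    by rewrite mulmxBl -mulmxA df_df mulmx0 sub0r opprK scalemxAl.
  by apply: (submodN (mxin_submod ida _ _)); exact: mxinMr.
have [|y xy] := IHl i.+1 (ltnW ls) (leqW li) _ (x - xs`_l *: W).
  have -> : (x - xs`_l *: W) *m df D i.+1 =
      (x *m df D i.+1 - xs`_l *: Y) + xs`_l *: (Y - W *m df D i.+1).
    by mxring.
  apply: (submodD (mxin_submod ida _ _)) => //.
  exact: (submodZ (mxin_submod ida _ _)).
exists y; apply: (mxin_take_widen (Y := W)) => //.
by rewrite addrAC.
Qed.

(** The relation modulo [aa l.+1] has a defect x_l u modulo [aa l]. Regularity and exactness of [E]
    show that u satisfies the relation for degree [i], and the vanishing of that lower Tor absorbs
    u. *)
Lemma tor_mod_regular (D E : fcomplex R) : (forall i, exact_mod (aa 0) E i) ->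
  (forall i j, tor_mod (aa 0) D E i j) ->
  forall l i j, (l <= size xs)%N -> (l <= i)%N -> (l <= j)%N ->
  tor_mod (aa l) D E i j.
Proof.
move=> exE torDE; elim=> [|l IHl] // [|i] // [|j] // ls li lj w v.
move=> /(mxin_takeS ls)[u wvu].
have ida := ideal_genP (take l xs).
have DD : (df D i)^T *m (df D i.+1)^T = 0 by rewrite -trmx_mul df_df trmx0.
have := @exact_mod_regular E exE l j (ltnW ls) lj _ ((df D i)^T *m u).
case=> [|s us].
  apply: (mxin_take_reg ls).
  have -> : xs`_l *: ((df D i)^T *m u *m df E j) =
     - ((df D i)^T *m ((df D i.+1)^T *m w - v *m df E j.+1 - xs`_l *: u)
         *m df E j).
    rewrite !mulmxBr mulmxA DD mul0mx sub0r !mulmxBl mulNmx -!mulmxA df_df.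
    by rewrite !mulmx0; mxring.
  by apply: (submodN (mxin_submod ida _ _)); apply: mxinMr => //; exact: mxinMl.
have [u' [u'' uE]] := IHl i j.+1 (ltnW ls) li (leqW lj) u s us.
have [|w' [v' wE]] := IHl i.+1 j.+1 (ltnW ls) (leqW li) (leqW lj)
    (w - xs`_l *: u') (v + xs`_l *: u'').
  have -> : (df D i.+1)^T *m (w - xs`_l *: u') -
       (v + xs`_l *: u'') *m df E j.+1 =
     ((df D i.+1)^T *m w - v *m df E j.+1 - xs`_l *: u) +
     xs`_l *: (u - (df D i.+1)^T *m u' - u'' *m df E j.+1) by mxring.
  apply: (submodD (mxin_submod ida _ _)) => //.
  exact: (submodZ (mxin_submod ida _ _)).
exists w', v'; apply: (mxin_take_widen (Y := u')) => //.
have -> // : w - (df D i.+2)^T *m w' - v' *m df E j.+1 - xs`_l *: u' =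
   w - xs`_l *: u' - (df D i.+2)^T *m w' - v' *m df E j.+1 by mxring.
Qed.

End RegularSequence.

(** * Syzygies over a fiber product *)

Section Core.
Variables (R : comNzRingType) (m a : R -> Prop).
Hypotheses (idm : ideal m) (ida : ideal a).
Hypothesis m_proper : ~ m 1.
Hypothesis m_unit : forall x, ~ m x -> exists u, u * x = 1.
Hypothesis sub_am : forall x, a x -> m x.

(** The sums of [p l * q l] run through mI, so [y] lies in I but not in mI + a. *)
Definition min_gen_mod (I : R -> Prop) (y : R) : Prop :=
  I y /\ forall n (p q : 'I_n -> R),
    (forall l, m (p l)) -> (forall l, I (q l)) -> ~ a (y - \sum_l p l * q l).

(* The fiber product structure of R/a, expressed by ideals of R. *)
Record splits (I J : R -> Prop) : Prop := Splits {
  split_idl : ideal I;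
  split_idr : ideal J;
  split_subl : forall x, a x -> I x;
  split_subr : forall x, a x -> J x;
  split_ml : forall x, I x -> m x;
  split_mr : forall x, J x -> m x;
  split_cap : forall x, I x -> J x -> a x;
  split_add : forall x, m x -> exists2 y, I y & J (x - y);
  split_genl : exists y, min_gen_mod I y;
  split_genr : exists y, min_gen_mod J y
}.

Lemma splits_sym I J : splits I J -> splits J I.
Proof.
case=> idI idJ aI aJ Im Jm IJ mIJ gI gJ; split=> // [x Jx Ix|x /mIJ[y Iy Jxy]].
  exact: IJ.
by exists (x - y); rewrite // subKr.
Qed.

Lemma splits_mul I J x y : splits I J -> I x -> J y -> a (x * y).
Proof.
move=> sIJ Ix Jy; apply: (split_cap sIJ).
  exact: ideal_mulr _ (split_idl sIJ) Ix.
exact: ideal_mull _ (split_idr sIJ) Jy.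
Qed.

Lemma splits_mx I J p q (A : 'M_(p, q)) : splits I J -> mxin m A ->
  exists B C, [/\ A = B + C, mxin I B & mxin J C].
Proof.
move=> sIJ mA.
have [|B BP] := mxin_choice (b := fun x y => I y /\ J (x - y)) _ mA.
  by move=> x /(split_add sIJ)[y]; exists y.
exists B, (A - B); split=> [|i j|i j]; first by rewrite addrC subrK.
  by case: (BP i j).
by rewrite !mxE; case: (BP i j).
Qed.

(* Some minimal generator of the (c+1)-st syzygy has all its entries in I. *)
Definition has_gen (I : R -> Prop) (D : fcomplex R) (c : nat) : Prop :=
  exists e : 'rV_(rk D c.+1), ~ mxin m e /\ mxin I (e *m df D c).

Lemma not_mxinP p q (A : 'M_(p, q)) : ~ mxin m A -> exists i j, ~ m (A i j).
Proof. by move=> /existsNP[i /existsNP[j mAij]]; exists i, j. Qed.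

Section Step.
Variables (I J : R -> Prop) (D : fcomplex R) (c : nat).
Hypothesis sIJ : splits I J.
Hypothesis exD : exact_mod a D c.
Hypothesis mD : mxin m (df D c.+1).

(** Were all entries of [f] in m, split [f = g + h] along I and J. The image of [g] has entries in I
    and in J, hence in a, so y e is congruent to the image of [h]. The coordinate where [e] is a
    unit then puts [y] into mJ + a, against minimality. *)
Lemma has_gen_stepE (e : 'rV_(rk D c.+1)) y : ~ mxin m e ->
  mxin I (e *m df D c) -> min_gen_mod J y ->
  exists f : 'rV_(rk D c.+2), ~ mxin m f /\ mxin a (y *: e - f *m df D c.+1).
Proof.
move=> me Ie [Jy miny].
have [|f yef] := exD (x := y *: e).
  move=> i j; rewrite -scalemxAl mxE mulrC.
  exact: splits_mul sIJ _ _.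
exists f; split=> // mf.
have [g [h [fE Ig Jh]]] := splits_mx sIJ mf.
have [i [j meij]] := not_mxinP me.
have {i}meij : ~ m (e 0 j) by rewrite (ord1 i) in meij.
have agD : mxin a (g *m df D c.+1).
  move=> k l; apply: (split_cap sIJ).
    by apply: mxinMr; [case: sIJ | exact: Ig].
  have -> : g *m df D c.+1 = y *: e - (y *: e - f *m df D c.+1) -
      h *m df D c.+1 by rewrite fE; mxring.
  move: k l.
  apply: (submodB (mxin_submod (split_idr sIJ) _ _)); last first.
    by apply: mxinMr; [case: sIJ | exact: Jh].
  apply: (submodB (mxin_submod (split_idr sIJ) _ _)).
    by apply: mxinZl; [case: sIJ | exact: Jy].
  by move=> k l; apply: (split_subr sIJ).
have ayeh : mxin a (y *: e - h *m df D c.+1).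
  have -> : y *: e - h *m df D c.+1 =
    y *: e - f *m df D c.+1 + g *m df D c.+1 by rewrite fE; mxring.
  by apply: (submodD (mxin_submod ida _ _)).
have [u uE] := m_unit meij.
apply: (miny _ (fun l => u * df D c.+1 l j) (fun l => h 0 l)).
- by move=> l; apply: ideal_mull.
- by move=> l; apply: Jh.
have -> : y - \sum_l u * df D c.+1 l j * h 0 l =
    u * (y *: e - h *m df D c.+1) 0 j.
  rewrite !mxE mulrBr mulrCA uE mulr1 mulr_sumr; congr (_ - _).
  by apply: eq_bigr => l _; rewrite mulrAC mulrA.
exact: ideal_mull.
Qed.

Lemma has_gen_step : has_gen I D c -> has_gen J D c.+1.
Proof.
case=> e [me Ie]; have [y minJ] := split_genr sIJ.
have [f [mf yef]] := has_gen_stepE me Ie minJ.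
exists f; split=> //.
have -> : f *m df D c.+1 = y *: e - (y *: e - f *m df D c.+1) by mxring.
apply: (submodB (mxin_submod (split_idr sIJ) _ _)).
  by apply: mxinZl; [case: sIJ | case: minJ].
by move=> k l; apply: (split_subr sIJ).
Qed.

End Step.

(* The second syzygy is a submodule of m F_1 = I F_1 + J F_1, and the kernel
   of the differential is compatible with this decomposition. *)
Lemma has_gen_start I J D q : splits I J -> exact_mod a D q ->
  exact_mod a D q.+1 -> mxin m (df D q.+1) -> mxin m (df D q.+2) ->
  (0 < rk D q.+2)%N -> has_gen I D q.+1 \/ has_gen J D q.+1.
Proof.
move=> sIJ exq exq1 mq1 mq2 rk_gt0.
pose e : 'rV[R]_(rk D q.+2) := delta_mx 0 (Ordinal rk_gt0).
have [z1 [z2 [zE Iz1 Jz2]]] := splits_mx sIJ (mxinMl idm e mq1).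
(* The two images agree up to sign, so their entries lie in both I and J, hence in a: [z1] and [z2]
   are cycles separately. *)
have zq : z1 *m df D q = - (z2 *m df D q).
  by apply/eqP; rewrite -addr_eq0 -mulmxDl -zE -mulmxA df_df mulmx0.
have [|g gE] := exq _ z1.
  move=> i j; apply: (split_cap sIJ); first by apply: mxinMr; [case: sIJ | exact: Iz1].
  rewrite zq mxE; apply: (submodN (split_idr sIJ)).
  by apply: mxinMr; [case: sIJ | exact: Jz2].
have [|h hE] := exq _ z2.
  move=> i j; apply: (split_cap sIJ).
    rewrite -[_ *m _]opprK -zq mxE; apply: (submodN (split_idl sIJ)).
    by apply: mxinMr; [case: sIJ | exact: Iz1].
  by apply: mxinMr; [case: sIJ | exact: Jz2].
have [mg|mg] := pselect (mxin m g); last first.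
  left; exists g; split=> //.
  have -> : g *m df D q.+1 = z1 - (z1 - g *m df D q.+1) by mxring.
  apply: (submodB (mxin_submod (split_idl sIJ) _ _)) => // i j.
  exact: (split_subl sIJ).
have [mh|mh] := pselect (mxin m h); last first.
  right; exists h; split=> //.
  have -> : h *m df D q.+1 = z2 - (z2 - h *m df D q.+1) by mxring.
  apply: (submodB (mxin_submod (split_idr sIJ) _ _)) => // i j.
  exact: (split_subr sIJ).
(* If both lifts have entries in m, the cycle e - g - h is a boundary modulo a, which puts the basis
   vector [e] into m. *)
have [|f fE] := exq1 _ (e - g - h).
  have -> : (e - g - h) *m df D q.+1 =
     (z1 - g *m df D q.+1) + (z2 - h *m df D q.+1).
    by rewrite !mulmxBl zE; mxring.
  exact: (submodD (mxin_submod ida _ _)).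
have me : mxin m e.
  have -> : e = (e - g - h - f *m df D q.+2) + f *m df D q.+2 + g + h by mxring.
  do 3?[apply: (submodD (mxin_submod idm _ _)) => //]; last exact: mxinMl.
  by move=> i j; apply: sub_am.
have := me 0 (Ordinal rk_gt0); by rewrite mxE !eqxx => /m_proper.
Qed.

Lemma mxin_outer p q (f : 'rV_p) (u : 'rV_q) : mxin m (f^T *m u) ->
  mxin m f \/ mxin m u.
Proof.
move=> mfu; have [|mf] := pselect (mxin m f); [by left | right].
have [i [j mfij]] := not_mxinP mf; have [v vE] := m_unit mfij.
move=> k l; rewrite -[u k l]mul1r -vE -mulrA; apply: ideal_mull => //.
have := mfu j l; rewrite !mxE big_ord1 !mxE.
by rewrite (ord1 i) (ord1 k).
Qed.

(** With [f] lifting x e, the matrix [f^T *m u] stands for f tensor u. It is a Tor cycle, since x e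
    tensor u equals e tensor x u and x u is a boundary: x in I kills J modulo a. Boundaries have
    entries in m, but an outer product of two vectors with unit entries has a unit entry. *)
Lemma has_gen_tor I J D E c c' : splits I J ->
  exact_mod a D c -> exact_mod a E c' ->
  mxin m (df D c.+1) -> mxin m (df D c.+2) -> mxin m (df E c'.+1) ->
  tor_mod a D E c.+1 c'.+1 -> has_gen J D c -> has_gen J E c' -> False.
Proof.
move=> sIJ exD exE mD1 mD2 mE tor [e [me Je]] [u [mu Ju]].
have [x minI] := split_genl sIJ; have Ix := minI.1.
have [f [mf xef]] := has_gen_stepE (splits_sym sIJ) exD mD1 me Je minI.
have [|v xuv] := exE _ (x *: u).
  move=> i j; rewrite -scalemxAl mxE.
  exact: splits_mul sIJ _ _.
have [|w' [v' wE]] := tor (f^T *m u) (e^T *m v).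
  have -> : (df D c.+1)^T *m (f^T *m u) - e^T *m v *m df E c'.+1 =
      - (x *: e - f *m df D c.+1)^T *m u + e^T *m (x *: u - v *m df E c'.+1).
    rewrite !linearB /= !linearZ /= trmx_mul; mxring.
  apply: (submodD (mxin_submod ida _ _)); last exact: mxinMl.
  rewrite mulNmx; apply: (submodN (mxin_submod ida _ _)).
  by apply: mxinMr => //; apply: mxin_tr.
suff : mxin m (f^T *m u) by case/mxin_outer.
have -> : f^T *m u = (f^T *m u - (df D c.+2)^T *m w' - v' *m df E c'.+1) +
    (df D c.+2)^T *m w' + v' *m df E c'.+1 by mxring.
do 2?[apply: (submodD (mxin_submod idm _ _)) => //]; last exact: mxinMl.
  by move=> i j; apply: sub_am.
by apply: mxinMr => //; apply: mxin_tr.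
Qed.

Theorem core I J D E q : splits I J ->
  (forall i, (q <= i)%N -> exact_mod a D i) ->
  (forall i, (q <= i)%N -> exact_mod a E i) ->
  (forall i, (q < i)%N -> mxin m (df D i)) ->
  (forall i, (q < i)%N -> mxin m (df E i)) ->
  (forall i j, (q <= i)%N -> (q <= j)%N -> tor_mod a D E i j) ->
  rk D q.+2 = 0%N \/ rk E q.+2 = 0%N.
Proof.
move=> sIJ exD exE mD mE tor.
have [->|D0] := posnP (rk D q.+2); [by left | right].
apply/eqP; rewrite -leqn0 leqNgt; apply/negP => E0.
have le1 k : (q < (q + k).+1)%N by rewrite ltnS leq_addr.
have := le1 1; have := le1 2; have := le1 3; have := le1 0.
rewrite !addnS addn0 => q1 q4 q3 q2.
have sD := has_gen_start sIJ (exD _ (leqnn q)) (exD _ (ltnW q1)) (mD _ q1) (mD _ q2) D0.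
have sE := has_gen_start sIJ (exE _ (leqnn q)) (exE _ (ltnW q1)) (mE _ q1) (mE _ q2) E0.
(* [has_gen_tor] asks for the same type in both resolutions; if [D] has the opposite one, a further
   step in [D] switches it. *)
have {D0 E0 exE mE} fin I' J' : splits I' J' -> has_gen J' E q.+1 ->
    has_gen I' D q.+1 \/ has_gen J' D q.+1 -> False.
  move=> sIJ' gE [gD|gD].
    have {}gD := has_gen_step sIJ' (exD _ (ltnW q1)) (mD _ q2) gD.
    by apply: (has_gen_tor sIJ' _ _ _ _ _ _ gD gE); auto using ltnW.
  by apply: (has_gen_tor sIJ' _ _ _ _ _ _ gD gE); auto using ltnW.
case: sE => gE; last exact: fin sIJ gE sD.
by apply: (fin _ _ (splits_sym sIJ) gE); case: sD => gD; [right | left].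
Qed.

End Core.

(** * Generators, Nakayama and prime ideals *)

Section Generation.
Variables (R : comNzRingType) (m : R -> Prop).
Hypothesis idm : ideal m.
Hypothesis m_proper : ~ m 1.
Hypothesis m_unit : forall x, ~ m x -> exists u, u * x = 1.

Section Modulo.
Variables (V : lmodType R) (K B : V -> Prop).
Hypothesis subB : submodule B.

Definition generates n (g : 'I_n -> V) : Prop :=
  (forall i, K (g i)) /\
  forall x, K x -> exists c : 'I_n -> R, B (x - \sum_i c i *: g i).

Lemma generates_drop n (g : 'I_n.+1 -> V) (c : 'I_n.+1 -> R) j :
  generates g -> B (\sum_i c i *: g i) -> ~ m (c j) ->
  generates (fun i => g (lift j i)).
Proof.
move=> [Kg gen] Bc /m_unit[u uc]; split=> // x /gen[d Bd].
exists (fun i => d (lift j i) - d j * u * c (lift j i)).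
have -> : x - \sum_i (d (lift j i) - d j * u * c (lift j i)) *: g (lift j i) =
    (x - \sum_i d i *: g i) + (d j * u) *: \sum_i c i *: g i.
  rewrite (bigD1_ord j) //= (bigD1_ord j (F := fun i => c i *: _)) //=.
  rewrite scalerDr scalerA -mulrA uc mulr1 scaler_sumr.
  under eq_bigr do rewrite scalerBl -scalerA.
  rewrite sumrB opprB opprD !addrA addrAC; congr (_ + _).
  by rewrite [RHS]addrAC subrK.
apply: (submodD subB) => //; exact: (submodZ subB).
Qed.

Lemma generates_min n (g : 'I_n -> V) : generates g ->
  exists k (h : 'I_k -> V), generates h /\
    forall c : 'I_k -> R, B (\sum_i c i *: h i) -> forall i, m (c i).
Proof.
elim: n g => [|n IHn] g gen; first by exists 0, g; split=> // c _ [].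
have [min|] := pselect (forall c : 'I_n.+1 -> R,
    B (\sum_i c i *: g i) -> forall i, m (c i)); first by exists n.+1, g.
move=> /existsNP[c /not_implyP[Bc /existsNP[j mcj]]].
exact: IHn (generates_drop gen Bc mcj).
Qed.

(** A minimal system of generators is empty: otherwise its first member, written in mK + B, gives a
    relation with first coefficient 1 - f_0 and f_0 in m, and minimality puts 1 into m. *)
Lemma nakayama n (g : 'I_n -> V) : submodule K -> generates g ->
  (forall y, K y -> exists k (p : 'I_k -> R) (q : 'I_k -> V),
     [/\ forall l, m (p l), forall l, K (q l) & B (y - \sum_l p l *: q l)]) ->
  forall y, K y -> B y.
Proof.
move=> subK /generates_min[k [h [genh minh]]] Km y /genh.2[c].
case: k h c genh minh => [|k] h c genh minh; first by rewrite big_ord0 subr0.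
have [r [p [q [mp Kq Bpq]]]] := Km _ (genh.1 ord0).
have /choice[d dP] l : exists d : 'I_k.+1 -> R, B (q l - \sum_i d i *: h i).
  exact: genh.2.
pose f i := \sum_l p l * d l i.
have mf i : m (f i).
  by apply: (submod_sum idm) => l; apply: ideal_mulr.
have Bf : B (\sum_i ((i == ord0)%:R - f i) *: h i).
  have -> : \sum_i ((i == ord0)%:R - f i) *: h i = (h ord0 - \sum_l p l *: q l) +
      \sum_l p l *: (q l - \sum_i d l i *: h i).
    under eq_bigr do rewrite scalerBl.
    under [X in _ = _ + X]eq_bigr do rewrite scalerBr scaler_sumr.
    rewrite !sumrB addrA subrK; congr (_ - _).
      rewrite (bigD1 ord0) //= scale1r big1 ?addr0 // => i /negPf ->.
      by rewrite scale0r.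
    rewrite exchange_big /=; apply: eq_bigr => i _; rewrite scaler_suml.
    by apply: eq_bigr => l _; rewrite scalerA.
  apply: (submodD subB) => //; apply: (submod_sum subB) => l.
  exact: (submodZ subB).
case: m_proper; have := minh _ Bf ord0; rewrite eqxx /= => m1f.
by rewrite -[1](subrK (f ord0)); apply: (submodD idm).
Qed.

End Modulo.
End Generation.

(** * Submodules of free modules over Noetherian and local rings *)

Section Noetherian.
Variables (R : comNzRingType).
Hypothesis noethR : noetherian R.

Lemma noetherian_ideal (a : R -> Prop) : ideal a ->
  exists s, forall x, a x <-> ideal_gen s x.
Proof.
move=> ida; have [|s sP] := noethR (I := fun x : R^o => `[< a x >]).
  split=> [|c u v /asboolP au /asboolP av]; apply/asboolP.
    exact: submod0 ida.
  by apply: ida.2.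
by exists s => x; rewrite -sP; split=> /asboolP.
Qed.

(** Induction on the number of columns: the rows of K starting with 0 form a submodule in fewer
    columns, the first entries of K an ideal. [G0] and [H] lift generators of the two. *)
Lemma noetherian_rows n (K : 'rV[R]_n -> Prop) : submodule K ->
  exists s (G : 'M_(s, n)), forall x, K x <-> exists c, x = c *m G.
Proof.
elim: n K => [|n IHn] K subK.
  exists 0%N, 0 => x; split=> [_|_]; first by exists 0; apply/matrixP => i [].
  by rewrite thinmx0; exact: submod0 subK.
pose K' (y : 'rV_n) := K (row_mx (0 : 'M_(1, 1)) y).
have rowD c p q (u v : 'rV[R]_n) : row_mx (c *: p + q) (c *: u + v) =
    c *: row_mx (p : 'M_(1, 1)) u + row_mx q v :> 'rV_(1 + n).
  by rewrite scale_row_mx add_row_mx.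
have [|s [G GP]] := IHn K'.
  split=> [|c u v Ku Kv]; first by rewrite /K' row_mx0; exact: submod0 subK.
  by have := rowD c 0 0 u v; rewrite /K' scaler0 addr0 => ->; exact: subK.2.
pose a (x : R) := exists y, K (row_mx x%:M y : 'rV_(1 + n)).
have [|r aP] := @noetherian_ideal a.
  split=> [|c u v [y Ky] [z Kz]].
    by exists 0; rewrite [0%:M]raddf0 row_mx0; exact: submod0 subK.
  exists (c *: y + z); rewrite raddfD /= -scale_scalar_mx rowD.
  exact: subK.2.
have /choice[Y YP] (i : 'I_(size r)) : exists y, K (row_mx (r`_i)%:M y : 'rV_(1 + n)).
  apply/aP; exists (fun j => (j == i)%:R); rewrite (bigD1 i) //= eqxx mul1r.
  by rewrite big1 ?addr0 // => j /negPf ->; rewrite mul0r.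
pose H : 'M[R]_(size r, 1 + n) := \matrix_i (row_mx (r`_i)%:M (Y i)).
have KH (c : 'rV_(size r)) : K (c *m H).
  rewrite mulmx_sum_row; apply: (submod_sum subK) => i.
  by apply: (submodZ subK); rewrite rowK.
pose G0 : 'M[R]_(s, 1 + n) := row_mx 0 G.
have mulG (d : 'rV_s) : d *m G0 = row_mx 0 (d *m G) by rewrite mul_mx_row mulmx0.
exists (size r + s)%N, (col_mx H G0) => x; split; last first.
  case=> c ->; rewrite -[c]hsubmxK mul_row_col; apply: (submodD subK) => //.
  by rewrite mulG; apply/GP; eexists.
rewrite -[x](@hsubmxK _ _ 1 n); set p := lsubmx _; set y := rsubmx _ => Kx.
have [|c cE] := (aP (p 0 0)).1; first by exists y; rewrite -mx11_scalar.
pose c' : 'rV_(size r) := \row_i c i.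
have pE : lsubmx (c' *m H) = p.
  rewrite [p]mx11_scalar cE; apply/matrixP => i j; rewrite !mxE.
  rewrite (ord1 i) (ord1 j) eqxx mulr1n; apply: eq_bigr => k _.
  by rewrite !mxE; case: splitP => // l _; rewrite (ord1 l) mxE eqxx mulr1n.
have /GP[d dE] : K' (y - rsubmx (c' *m H)).
  rewrite /K' -(subrr p) -{2}pE -[p - _]addrC -[y - _]addrC -!scaleN1r rowD.
  by rewrite hsubmxK; apply: subK.2.
exists (row_mx c' d); rewrite mul_row_col mulG -dE.
set z := rsubmx _; have -> : c' *m H = row_mx p z by rewrite -pE hsubmxK.
by have := rowD 1 p 0 z (y - z); rewrite !scale1r addr0 [z + _]addrC subrK.
Qed.

End Noetherian.

Section LocalRing.
Variables (R : comNzRingType) (m : R -> Prop).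
Hypothesis noethR : noetherian R.
Hypothesis idm : ideal m.
Hypothesis m_proper : ~ m 1.
Hypothesis m_unit : forall x, ~ m x -> exists u, u * x = 1.

Lemma ideal_nakayama (K B : R -> Prop) : ideal K -> ideal B ->
  (forall y, K y -> exists n (p q : 'I_n -> R),
     [/\ forall l, m (p l), forall l, K (q l) & B (y - \sum_l p l * q l)]) ->
  forall y, K y -> B y.
Proof.
move=> idK idB Km; have [s sP] := noetherian_ideal noethR idK.
apply: (@nakayama R m idm m_proper m_unit R^o K B idB (size s) (fun i => s`_i)) => //.
split=> [i|x /sP[c ->]]; last by exists c; rewrite subrr; exact: submod0 idB.
apply/sP; exists (fun j => (j == i)%:R); rewrite (bigD1 i) //= eqxx mul1r.
by rewrite big1 ?addr0 // => j /negPf ->; rewrite mul0r.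
Qed.

Lemma row_nakayama n (K B : 'rV[R]_n -> Prop) : submodule K -> submodule B ->
  (forall y, K y -> exists k (p : 'I_k -> R) (q : 'I_k -> 'rV_n),
     [/\ forall l, m (p l), forall l, K (q l) & B (y - \sum_l p l *: q l)]) ->
  forall y, K y -> B y.
Proof.
move=> subK subB Km; have [s [G GP]] := noetherian_rows noethR subK.
apply: (@nakayama R m idm m_proper m_unit 'rV[R]_n K B subB s (fun i => row i G)) => //.
split=> [i|x /GP[c ->]]; first by apply/GP; exists (delta_mx 0 i); rewrite -rowE.
by exists (c 0); rewrite -mulmx_sum_row subrr; exact: submod0 subB.
Qed.

Lemma minimal_rows n (K : 'rV[R]_n -> Prop) : submodule K ->
  exists s (G : 'M_(s, n)), (forall x, K x <-> exists c, x = c *m G) /\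
    forall c : 'rV_s, c *m G = 0 -> mxin m c.
Proof.
move=> subK; have [s [G GP]] := noetherian_rows noethR subK.
have sub0 : submodule (fun x : 'rV[R]_n => x = 0).
  by split=> // c u v -> ->; rewrite scaler0 addr0.
have [|k [h [[Kh genh] minh]]] := generates_min m_unit sub0 (K := K) (g := fun i => row i G).
  split=> [i|x /GP[c ->]]; first by apply/GP; exists (delta_mx 0 i); rewrite -rowE.
  by exists (c 0); rewrite -mulmx_sum_row subrr.
exists k, (\matrix_i h i); split=> [x|c c0 i j]; last first.
  rewrite (ord1 i); apply: minh; rewrite -[RHS]c0 mulmx_sum_row.
  by apply: eq_bigr => l _; rewrite rowK.
split=> [/genh[c /eqP]|[c ->]]; last first.
  rewrite mulmx_sum_row; apply: (submod_sum subK) => l.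
  by apply: (submodZ subK); rewrite rowK.
rewrite subr_eq0 => /eqP ->; exists (\row_i c i); rewrite mulmx_sum_row.
by apply: eq_bigr => l _; rewrite rowK mxE.
Qed.

Lemma minimal_gen_modP (a I : R -> Prop) : ideal I -> ideal a ->
  (exists2 x, I x & ~ a x) -> exists y, min_gen_mod m a I y.
Proof.
move=> idI ida [x Ix nax]; apply: contrapT => nmin; apply: nax.
apply: (ideal_nakayama idI ida) Ix => y Iy; apply: contrapT => ny.
by apply: nmin; exists y; split=> // n p q mp Iq ayq; apply: ny; exists n, p, q.
Qed.

End LocalRing.

(** * Ideals maximal among those avoiding a set *)

Section Primes.
Variable R : comNzRingType.

Lemma ideal_avoiding (a W : R -> Prop) : ideal a -> (forall x, a x -> ~ W x) ->
  exists p : R -> Prop, [/\ ideal p, forall x, a x -> p x,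
    forall x, p x -> ~ W x &
    forall b : R -> Prop, ideal b -> (forall x, p x -> b x) ->
      (forall x, b x -> ~ W x) -> forall x, b x -> p x].
Proof.
move=> ida aW.
pose good (p : R -> Prop) :=
  [/\ ideal p, forall x, a x -> p x & forall x, p x -> ~ W x].
pose P (p : R -> Prop) := good p \/ forall x, ~ p x.
have [F FP Ftot|p [Pp maxp]] := @classical_sets.Zorn_bigcup R P.
  have [Fgood|F0] := pselect (exists2 p, F p & good p); last first.
    right=> x [p Fp px]; have [gp|p0] := FP p Fp; last exact: p0 px.
    by apply: F0; exists p.
  have [p0 Fp0 [idp0 ap0 p0W]] := Fgood.
  left; split=> [|x /ap0 p0x|x [p Fp px]]; last 2 first.
  - by exists p0.
  - have [[_ _ pW]|p_0] := FP p Fp; [exact: pW | by case: (p_0 x)].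
  split=> [|c u v [p Fp pu] [q Fq qv]]; first by exists p0 => //; exact: submod0 idp0.
  have [pq|qp] := Ftot _ _ Fp Fq.
    have [[idq _ _]|q_0] := FP q Fq; last by case: (q_0 v).
    by exists q => //; apply: idq.2 => //; exact: pq.
  have [[idp _ _]|p_0] := FP p Fp; last by case: (p_0 u).
  by exists p => //; apply: idp.2 => //; exact: qp.
have gooda : good a by split.
have [idp ap pW] : good p.
  case: Pp => // p_0; case: (maxp a); last by left.
  split=> [x /p_0 //|sub]; apply: (p_0 0); apply: sub; exact: submod0 ida.
exists p; split=> // b idb pb bW x bx; apply: contrapT => npx.
case: (maxp b); last by left; split=> // y /ap /pb.
by split=> [y /pb //|sub]; apply: npx; exact: sub.
Qed.

Lemma ideal_addP (p : R -> Prop) x : ideal p ->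
  ideal (fun z => exists2 y, p y & exists r, z = y + r * x).
Proof.
move=> idp; split; first by exists 0; [exact: submod0 idp | exists 0; rewrite mul0r addr0].
move=> c _ _ [y py [r ->]] [z pz [s ->]].
exists (c * y + z); first exact: idp.2.
by exists (c * r + s); rewrite [_ *: _]mulrDr mulrDl addrACA mulrA.
Qed.

(** For x and y outside a maximal p, both p + Rx and p + Ry meet W. If xy were in p, the product of
    the two meeting points would lie in p and in W. *)
Lemma prime_avoiding (a W : R -> Prop) : ideal a -> (forall x, a x -> ~ W x) ->
  W 1 -> (forall x y, W x -> W y -> W (x * y)) ->
  exists p : R -> Prop, [/\ ideal p, forall x, a x -> p x, forall x, p x -> ~ W x &
    forall x y, p (x * y) -> p x \/ p y].
Proof.
move=> ida aW W1 WM; have [p [idp ap pW maxp]] := ideal_avoiding ida aW.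
exists p; split=> // x y pxy; apply: contrapT => /not_orP[npx npy].
have meet z : ~ p z -> exists2 w, W w & exists2 u, p u & exists r, w = u + r * z.
  move=> npz; apply: contrapT => nW; apply: npz.
  apply: (maxp _ (ideal_addP z idp)) => [w pw|w pwz Ww|].
  - by exists w => //; exists 0; rewrite mul0r addr0.
  - by apply: nW; exists w.
  - by exists 0; [exact: submod0 idp | exists 1; rewrite mul1r add0r].
have [w Ww [u pu [r wE]]] := meet _ npx; have [z Wz [v pv [s zE]]] := meet _ npy.
apply: (pW _ _ (WM _ _ Ww Wz)); rewrite wE zE.
have -> : (u + r * x) * (v + s * y) = u * (v + s * y) + (r * x * v + r * s * (x * y)).
  by ring.
by do 2?[apply: (submodD idp)]; [apply: ideal_mulr|apply: ideal_mull|apply: ideal_mull].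
Qed.

Section Bundle.
Variables (p : R -> Prop) (idp : ideal p) (p1 : ~ p 1).

Lemma bundle_idealr_closed : idealr_closed (fun x : R => `[< p x >]).
Proof.
split=> [||c u v /asboolP pu /asboolP pv]; [apply/asboolP | | apply/asboolP].
- exact: submod0 idp.
- by apply/asboolPn.
- exact: idp.2.
Qed.

Definition bundle_idealr : idealr R :=
  HB.pack (fun x : R => `[< p x >]) (isIdealr.Build R _ bundle_idealr_closed).

Hypothesis p_prime : forall x y, p (x * y) -> p x \/ p y.

Lemma bundle_prime_closed : prime_idealr_closed bundle_idealr.
Proof. by move=> x y /asboolP/p_prime[px|py]; apply/orP; [left|right]; apply/asboolP. Qed.

Definition bundle_prime : prime_idealr R :=
  HB.pack (fun x : R => `[< p x >]) (isIdealr.Build R _ bundle_idealr_closed)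
    (isPrimeIdealrClosed.Build R _ bundle_prime_closed).

Lemma bundle_primeE x : x \in bundle_prime <-> p x.
Proof. by split=> /asboolP. Qed.

End Bundle.

Lemma idealr_ideal (I : idealr R) : ideal (fun x => x \in I).
Proof.
split; first exact: rpred0.
by move=> c u v Iu Iv; apply: rpredD => //; exact: idealMr.
Qed.

Definition nonunit (x : R) : Prop := ~ exists u, u * x = 1.

(** A nonunit generates an ideal without 1. It extends to an ideal maximal with this property, which
    is the maximal ideal. *)
Lemma local_nonunit : local_ring R -> ideal nonunit.
Proof.
case=> _ [m maxm uniqm].
suff mE x : nonunit x <-> x \in m.
  have [m0 mZ] := idealr_ideal m.
  by split=> [|c u v /mE mu /mE mv]; apply/mE => //; exact: mZ.
split=> [nx|mx [u ux]]; last by have := idealr1 m; rewrite -ux idealMr.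
have ida : ideal (fun z => exists2 y, y = 0 & exists r, z = y + r * x).
  apply: (@ideal_addP (fun y => y = 0)).
  by split=> // c u v -> ->; rewrite scaler0 addr0.
have [|p [idp ap pW maxp]] := @ideal_avoiding _ (fun w => w = 1) ida.
  by move=> _ [y -> [r ->]] /eqP; rewrite add0r => /eqP rx; apply: nx; exists r.
have p1 : ~ p 1 by move/pW.
rewrite -(uniqm (bundle_idealr idp p1)); last first.
  move=> J pJ y Jy; apply/asboolP.
  apply: (maxp _ (idealr_ideal J)) => // [z pz|z Jz z1].
    by apply: pJ; apply/asboolP.
  by move: Jz; rewrite z1 idealr1.
by apply/asboolP/ap; exists 0 => //; exists 1; rewrite mul1r add0r.
Qed.

End Primes.

(** * Dimension and the splitting of the maximal ideal *)

Section Dimension.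
Variables (R : comNzRingType) (xs : seq R).
Hypothesis regxs : regular_sequence xs.

Local Notation aa l := (ideal_gen (take l xs)).

Lemma regular_expr l k s : (l < size xs)%N -> aa l (s * xs`_l ^+ k) -> aa l s.
Proof.
move=> ls; elim: k s => [|k IHk] s; first by rewrite mulr1.
by rewrite exprS mulrCA => /(regxs.1 _ ls); exact: IHk.
Qed.

(** The chain is built downwards from [q]: a prime over [aa l] strictly inside [q] is found for each
    regular element. *)
Lemma prime_chain l (q : prime_idealr R) : (l <= size xs)%N ->
  (forall x, aa l x -> x \in q) ->
  exists c : nat -> prime_idealr R, c l = q /\ forall i, (i < l)%N ->
    {subset c i <= c i.+1} /\ ~ {subset c i.+1 <= c i}.
Proof.
elim: l q => [|l IHl] q ls aq; first by exists (fun=> q).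
have aS x : aa l x -> aa l.+1 x.
  by move=> ax; apply/(ideal_gen_takeS _ ls); exists 0; rewrite mulr0 subr0.
have xq : xs`_l \in q.
  apply/aq/(ideal_gen_takeS _ ls); exists 1.
  by rewrite mulr1 subrr; exact: (submod0 (ideal_genP (take l xs))).
(* Regularity keeps [W] away from [aa l]. A prime avoiding [W] lies in [q] and misses x_l, which is
   in [q]. *)
pose W w := exists2 s, s \notin q & exists k, w = s * xs`_l ^+ k.
have [|||p [idp ap pW p_prime]] := @prime_avoiding R (aa l) W (ideal_genP _).
- by move=> w + [s sq [k wE]]; rewrite wE => /(regular_expr ls)/aS/aq; exact/negP.
- by exists 1; [rewrite idealr1 | exists 0%N; rewrite mulr1].
- move=> w z [s sq [k ->]] [t tq [h ->]]; exists (s * t).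
    by rewrite prime_idealrM negb_or sq.
  by exists (k + h)%N; rewrite exprD mulrACA.
have p1 : ~ p 1.
  by move/pW; apply; exists 1; [rewrite idealr1 | exists 0%N; rewrite mulr1].
have [|c [cl cP]] := IHl (bundle_prime idp p1 p_prime) (ltnW ls).
  by move=> x /ap; exact: (bundle_primeE idp p1 p_prime x).2.
pose c' i := if (i <= l)%N then c i else q.
have c'E i : (i <= l)%N -> c' i = c i by rewrite /c' => ->.
have c'l : c' l.+1 = q by rewrite /c' ltnn.
exists c'; split=> // i.
rewrite ltnS leq_eqVlt => /predU1P[->|il]; last first.
  by rewrite !c'E // ?(ltnW il) //; exact: cP.
rewrite c'l c'E // cl; split=> [x /(bundle_primeE idp p1 p_prime x).1 px|sub].
  apply: contrapT => /negP nq; apply: (pW _ px); exists x => //.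
  by exists 0%N; rewrite mulr1.
have /(bundle_primeE idp p1 p_prime _).1/pW := sub _ xq; apply.
by exists 1; [rewrite idealr1 | exists 1%N; rewrite mul1r].
Qed.

Hypothesis localR : local_ring R.

Lemma nonunit_unit (x : R) : ~ nonunit x -> exists u, u * x = 1.
Proof. exact: contrapT. Qed.

Lemma nonunit1 : ~ nonunit (1 : R).
Proof. by apply; exists 1; rewrite mulr1. Qed.

Lemma nonunit_prime (x y : R) : nonunit (x * y) -> nonunit x \/ nonunit y.
Proof.
move=> nxy; apply: contrapT => /not_orP[/nonunit_unit[u ux] /nonunit_unit[v vy]].
by apply: nxy; exists (u * v); rewrite mulrACA ux vy mulr1.
Qed.

Lemma proper_nonunit (p : R -> Prop) x : ideal p -> ~ p 1 -> p x -> nonunit x.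
Proof. by move=> idp p1 px [u ux]; apply: p1; rewrite -ux; exact: ideal_mull. Qed.

Let m := bundle_prime (local_nonunit localR) nonunit1 nonunit_prime.

Lemma regular_size d : krull_dim_le R d -> (size xs <= d)%N.
Proof.
move=> dimR; have [|c [_ cP]] := @prime_chain (size xs) m (leqnn _).
  move=> x; rewrite take_size => ax; apply/bundle_primeE.
  by apply: proper_nonunit (ideal_genP xs) _ ax; case: regxs.
exact: dimR cP.
Qed.

(** A prime containing the sequence but not [x] would have [d] strict steps below it and the maximal
    ideal strictly above. *)
Lemma nonunit_nilpotent d : krull_dim_le R d -> size xs = d ->
  forall x, nonunit x -> exists k, ideal_gen xs (x ^+ k).
Proof.
move=> dimR sz x nx; apply: contrapT => nnil.
pose W w := exists k, w = x ^+ k.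
have [|||p [idp ap pW p_prime]] := @prime_avoiding R (ideal_gen xs) W (ideal_genP _).
- by move=> w + [k wE]; rewrite wE => ax; apply: nnil; exists k.
- by exists 0%N.
- by move=> w z [k ->] [h ->]; exists (k + h)%N; rewrite exprD.
have p1 : ~ p 1 by move/pW; apply; exists 0%N.
have [||c [cl cP]] := @prime_chain d (bundle_prime idp p1 p_prime).
- by rewrite sz.
- by move=> y; rewrite -sz take_size => /ap; exact: (bundle_primeE idp p1 p_prime y).2.
suff : (d.+1 <= d)%N by rewrite ltnn.
pose c' i := if (i <= d)%N then c i else m.
have c'E i : (i <= d)%N -> c' i = c i by rewrite /c' => ->.
have c'd : c' d.+1 = m by rewrite /c' ltnn.
apply: (dimR _ c') => i.
rewrite ltnS leq_eqVlt => /predU1P[->|il]; last first.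
  by rewrite !c'E // ?(ltnW il) //; exact: cP.
rewrite c'd c'E // cl; split=> [y /(bundle_primeE idp p1 p_prime y).1 py|sub].
  by apply/bundle_primeE; exact: proper_nonunit py.
have /sub/(bundle_primeE idp p1 p_prime x).1/pW : x \in m by apply/bundle_primeE.
by apply; exists 1%N.
Qed.

(** The witness is built one element at a time: multiply by the highest power of the new [f i] that
    stays outside the ideal. *)
Lemma nilpotent_socle n (f : 'I_n -> R) : (forall i, exists k, ideal_gen xs (f i ^+ k)) ->
  exists s, ~ ideal_gen xs s /\ forall i, ideal_gen xs (s * f i).
Proof.
have ida := ideal_genP xs.
elim: n f => [|n IHn] f nilf; first by exists 1; split=> [|[]//]; case: regxs.
have [s [ns sf]] := IHn (fun i => f (lift ord0 i)) (fun i => nilf _).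
have [k fk] := nilf ord0.
have ex : exists j, `[< ideal_gen xs (s * f ord0 ^+ j) >].
  by exists k; apply/asboolP; exact: ideal_mull.
case: (ex_minnP ex) => -[|j] /asboolP sj minj; first by rewrite mulr1 in sj.
exists (s * f ord0 ^+ j); split.
  by move=> sfj; have := minj j; rewrite ltnn => /(_ (introT (asboolP _) sfj)).
move=> i; case: (unliftP ord0 i) => [l ->|->]; last by rewrite -mulrA -exprSr.
by rewrite mulrAC; exact: ideal_mulr.
Qed.

End Dimension.

Section FiberSplitting.
Variable R : comNzRingType.
Hypothesis localR : local_ring R.
Variable a : idealr R.
Variables (k : fieldType) (S T : comNzRingType).
Variables (piS : {rmorphism S -> k}) (piT : {rmorphism T -> k}).
Hypothesis fiberR : is_fiber_product_of {ideal_quot a} piS piT.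

(** I and J are the preimages of m_S x 0 and 0 x m_T. Vanishing of one coordinate forces the other
    into the maximal ideal, as both have the same image in [k]. Neither is contained in [a] because
    [piS] and [piT] are not injective. *)
Lemma fiber_splits : exists I J, splits (@nonunit R) (fun x => x \in a) I J.
Proof.
have [_ [ontoS ontoT] [ninjS ninjT] [f [g fK gK]]] := fiberR.
pose phi (x : R) : S * T := fiber_val (f (\pi_{ideal_quot a} x)).
have phiP x : piS (phi x).1 = piT (phi x).2.
  by apply/eqP; have := fiber_valP (f (\pi_{ideal_quot a} x)).
have phi0 : phi 0 = 0 by rewrite /phi !rmorph0.
have phi1 : phi 1 = 1 by rewrite /phi !rmorph1.
have phiD x y : phi (x + y) = phi x + phi y by rewrite /phi !rmorphD.
have phiM x y : phi (x * y) = phi x * phi y by rewrite /phi !rmorphM.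
have phiB x y : phi (x - y) = phi x - phi y by rewrite /phi !rmorphB.
have onto_phi s t : piS s = piT t -> exists x, phi x = (s, t).
  move=> st; have stP : (s, t) \in fiber_pred piS piT by apply/eqP.
  exists (repr (g (FiberProduct stP))).
  by rewrite /phi reprK gK.
have ker_phi x : phi x = 0 -> x \in a.
  move=> phix0; have : \pi_{ideal_quot a} x = \pi_{ideal_quot a} 0.
    by apply: (can_inj fK); apply: val_inj; rewrite [LHS]phix0 -[LHS]phi0.
  by move/eqP; rewrite -Quotient.idealrBE subr0.
have aphi x : x \in a -> phi x = 0.
  rewrite -[x in x \in a]subr0 Quotient.idealrBE => /eqP E.
  by rewrite -phi0 /phi E.
have idn := local_nonunit localR.
have non x : nonunit x <-> piS (phi x).1 = 0.
  split=> [nx|kx [u ux]]; last first.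
    have := congr1 (fun x => piS (phi x).1) ux.
    by rewrite phiM phi1 /= rmorphM kx mulr0 rmorph1 => /esym/eqP; rewrite oner_eq0.
  apply: contrapT => /eqP kx.
  have [s sE] := ontoS (piS (phi x).1)^-1; have [t tE] := ontoT (piS (phi x).1)^-1.
  have [|y yE] := onto_phi s t; first by rewrite sE.
  (* [y] inverts [x] in [k], so 1 - y x vanishes there and is a nonunit. If [x] were one too, so
     would be 1. *)
  have xy1 : nonunit (1 - y * x).
    move=> [u ux]; have := congr1 (fun x => piS (phi x).1) ux.
    rewrite phiM phiB phiM phi1 yE /= rmorphM rmorphB rmorphM rmorph1 sE mulVf //.
    by rewrite subrr mulr0 => /esym/eqP; rewrite oner_eq0.
  suff : nonunit (1 : R) by exact: (@nonunit1 R).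
  rewrite -[1](subrK (y * x)); apply: (submodD idn) => //.
  exact: (ideal_mull _ idn).
exists (fun x => (phi x).2 = 0), (fun x => (phi x).1 = 0).
have idI : ideal (fun x => (phi x).2 = 0).
  split=> [|c u v u0 v0]; first by rewrite phi0.
  by rewrite phiD phiM /= u0 v0 mulr0 addr0.
have idJ : ideal (fun x => (phi x).1 = 0).
  split=> [|c u v u0 v0]; first by rewrite phi0.
  by rewrite phiD phiM /= u0 v0 mulr0 addr0.
have noninj (U : comNzRingType) (p : {rmorphism U -> k}) :
    ~ injective p -> exists2 s, s <> 0 & p s = 0.
  move=> ninj; apply: contrapT => nex; apply: ninj => s t st.
  apply/eqP; rewrite -subr_eq0; apply/eqP; apply: contrapT => nst.
  by apply: nex; exists (s - t) => //; rewrite rmorphB st subrr.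
have [noethR _] := localR.
have gen := minimal_gen_modP noethR idn (@nonunit1 R) (@nonunit_unit R).
split=> //.
- by move=> x /aphi ->.
- by move=> x /aphi ->.
- by move=> x x2; apply/non; rewrite phiP x2 rmorph0.
- by move=> x x1; apply/non; rewrite x1 rmorph0.
- by move=> x x2 x1; apply: ker_phi; rewrite [phi x]surjective_pairing x1 x2.
- move=> x /non x0; have [|y yE] := onto_phi (phi x).1 0; first by rewrite x0 rmorph0.
  by exists y; rewrite ?phiB yE //= subrr.
- apply: gen (idealr_ideal a) _ => //; have [s s0 ps] := noninj _ _ ninjS.
  have [|x xE] := onto_phi s 0; first by rewrite ps rmorph0.
  by exists x; rewrite ?xE // => /aphi; rewrite xE => -[].
- apply: gen (idealr_ideal a) _ => //; have [s s0 ps] := noninj _ _ ninjT.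
  have [|x xE] := onto_phi 0 s; first by rewrite ps rmorph0.
  by exists x; rewrite ?xE // => /aphi; rewrite xE => -[].
Qed.

End FiberSplitting.

(** * Comparison of projective resolutions *)

Section Kernel.
Variables (R : comNzRingType) (A B : lmodType R) (e : {linear A -> B}).

Definition ker_pred : {pred A} := [pred x | e x == 0].

Lemma ker_pred_closed : submod_closed ker_pred.
Proof.
split=> [|c u v]; rewrite !inE ?linear0 // => /eqP eu /eqP ev.
by rewrite linearP eu ev scaler0 addr0.
Qed.

HB.instance Definition _ :=
  GRing.isSubmodClosed.Build R A ker_pred ker_pred_closed.

Record ker_mod := KerMod { ker_val :> A; ker_valP : ker_val \in ker_pred }.

HB.instance Definition _ := [isSub for ker_val].
HB.instance Definition _ := [Choice of ker_mod by <:].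
HB.instance Definition _ := [SubChoice_isSubLmodule of ker_mod by <:].

End Kernel.

Definition pack_linear (R : comNzRingType) (A B : lmodType R) (f : A -> B)
  (f_lin : linear f) : {linear A -> B} := HB.pack f (GRing.isLinear.Build R A B *:%R f f_lin).

(** Projectivity lifts along surjections, so the codomain of [d] is cut down to the kernel of
    [e]. *)
Lemma projective_lift (R : comNzRingType) (P A B C : lmodType R)
    (d : {linear A -> B}) (e : {linear B -> C}) (g : {linear P -> B}) :
  projective P -> (forall b, e b = 0 <-> exists a, d a = b) ->
  (forall x, e (g x) = 0) -> exists h : {linear P -> A}, forall x, d (h x) = g x.
Proof.
move=> projP ex eg.
have dP x : d x \in ker_pred e by rewrite inE; apply/eqP/ex; exists x.
have gP x : g x \in ker_pred e by rewrite inE; apply/eqP.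
have d_lin : linear (fun x => KerMod (dP x) : ker_mod e).
  by move=> c u v; apply: val_inj; rewrite /= linearP.
have g_lin : linear (fun x => KerMod (gP x) : ker_mod e).
  by move=> c u v; apply: val_inj; rewrite /= linearP.
have [|h hP] := projP _ _ (pack_linear d_lin) (pack_linear g_lin).
  move=> [b /= be]; have /ex[x dx] : e b = 0 by apply/eqP.
  by exists x; apply: val_inj.
by exists h => x; have := congr1 (@ker_val _ _ _ _) (hP x).
Qed.

Section Comparison.
Variables (R : comNzRingType) (M : lmodType R).
Implicit Types P Q : proj_resolution M.

Lemma comparison P Q : exists f : forall n, {linear P n -> Q n},
  (forall x, res_aug Q (f 0%N x) = res_aug P x) /\
  forall n x, res_diff Q n (f n.+1 x) = f n (res_diff P n x).
Proof.
(* Invariant of the recursion: cycles go to cycles, so the next lift exists. In degree 0 the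
   augmentation acts as the differential. *)
pose Z n : {linear P n -> Q n} -> Prop :=
  match n with
  | 0%N => fun f => forall x, res_aug P x = 0 -> res_aug Q (f x) = 0
  | n.+1 => fun f => forall x, res_diff P n x = 0 -> res_diff Q n (f x) = 0
  end.
have [f0 f0P] := @res_projective _ _ P 0%N _ _ (res_aug Q) (res_aug P) (@res_aug_onto _ _ Q).
have Z0 : Z 0%N f0 by move=> x x0; rewrite f0P.
have dP n x : match n return P n -> Prop with
    | 0%N => fun x => res_aug P x = 0
    | n.+1 => fun x => res_diff P n x = 0 end (res_diff P n x).
  by case: n x => [|n] x; [apply/res_exact0|apply/res_exactS]; exists x.
have step n (f : {f | Z n f}) : {g : {g | Z n.+1 g} |
    forall x, res_diff Q n (sval g x) = sval f (res_diff P n x)}.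
  apply: cid; case: f => f Zf /=.
  have [g gP] : exists g : {linear P n.+1 -> Q n.+1},
      forall x, res_diff Q n (g x) = f (res_diff P n x).
    case: n f Zf => [|n] f Zf.
      apply: (projective_lift (g := f \o res_diff P 0%N) (@res_projective _ _ P _)
        (@res_exact0 _ _ Q)) => x.
      exact: Zf (dP 0%N x).
    apply: (projective_lift (g := f \o res_diff P n.+1) (@res_projective _ _ P _)
      (@res_exactS _ _ Q n)) => x.
    exact: Zf (dP n.+1 x).
  have Zg : Z n.+1 g by move=> x x0; rewrite gP x0 linear0.
  by exists (exist _ g Zg).
pose F := fix F n : {f | Z n f} :=
  if n is n'.+1 then sval (step n' (F n')) else exist _ f0 Z0.
exists (fun n => sval (F n)); split=> [|n x]; first exact: f0P.
exact: (svalP (step n (F n))).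
Qed.

Lemma null_homotopic P (g : forall n, {linear P n -> P n}) :
  (forall x, res_aug P (g 0%N x) = 0) ->
  (forall n x, res_diff P n (g n.+1 x) = g n (res_diff P n x)) ->
  exists h : forall n, {linear P n -> P n.+1}, forall n x,
    g n.+1 x = res_diff P n.+1 (h n.+1 x) + h n (res_diff P n x).
Proof.
move=> g0 gd.
have dd n x : res_diff P n (res_diff P n.+1 x) = 0 by apply/res_exactS; exists x.
(* A homotopy correct on boundaries makes [g n.+1] minus [h] after the differential take values in
   cycles. *)
pose Z n (h : {linear P n -> P n.+1}) := forall x,
  g n (res_diff P n x) = res_diff P n (h (res_diff P n x)).
have [h0 h0P] := projective_lift (@res_projective _ _ P _) (@res_exact0 _ _ P) g0.
have Z0 : Z 0%N h0 by move=> x; rewrite h0P.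
have step n (h : {h | Z n h}) : {h' : {h' | Z n.+1 h'} | forall x,
    g n.+1 x = res_diff P n.+1 (sval h' x) + sval h (res_diff P n x)}.
  apply: cid; case: h => h Zh /=.
  have [|h' h'P] := projective_lift (g := g n.+1 \- (h \o res_diff P n))
    (@res_projective _ _ P _) (@res_exactS _ _ P n).
    by move=> x; rewrite /= linearB /= gd Zh subrr.
  have Zh' : Z n.+1 h' by move=> x; rewrite h'P /= dd linear0 subr0.
  by exists (exist _ h' Zh') => x; rewrite /= h'P /= subrK.
pose F := fix F n : {h | Z n h} :=
  if n is n'.+1 then sval (step n' (F n')) else exist _ h0 Z0.
by exists (fun n => sval (F n)) => n x; exact: (svalP (step n (F n))).
Qed.

Lemma homotopy_equivalence P Q : exists (f : forall n, {linear Q n -> P n})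
    (g : forall n, {linear P n -> Q n}) (h : forall n, {linear Q n -> Q n.+1}),
  [/\ forall n x, res_diff P n (f n.+1 x) = f n (res_diff Q n x),
      forall n x, res_diff Q n (g n.+1 x) = g n (res_diff P n x) &
      forall n x, g n.+1 (f n.+1 x) =
        x + (res_diff Q n.+1 (h n.+1 x) + h n (res_diff Q n x))].
Proof.
have [f [f0 fd]] := comparison Q P; have [g [g0 gd]] := comparison P Q.
have [||h hP] := @null_homotopic Q (fun n => (g n \o f n) \- idfun).
- by move=> x; rewrite /= linearB /= g0 f0 subrr.
- by move=> n x; rewrite /= linearB /= gd fd.
exists f, g, h; split=> // n x.
by rewrite -hP /= addrC subrK.
Qed.

End Comparison.

(** * Independence of Tor and Ext from the resolution *)

Section TensorFacts.
Variables (R : comNzRingType) (N : lmodType R).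

Lemma tensor_ind (M : lmodType R) (P : tensor M N -> Prop) : P 0 ->
  (forall x y t, P t -> P (pure x y + t)) -> forall t, P t.
Proof.
move=> P0 PS t; rewrite -(tsum_repr t); elim: (repr t) => [|[x y] s IHs] //.
have -> : tsum ((x, y) :: s) = pure x y + tsum s by rewrite [RHS]tensor_addE.
exact: PS.
Qed.

Lemma tensor_map_pure (M M' : lmodType R) (f : {linear M -> M'}) x y :
  tensor_map f (pure x y : tensor M N) = pure (f x) y.
Proof. by rewrite tensor_mapE. Qed.

Lemma pureDl (M : lmodType R) (x x' : M) (y : N) :
  pure (x + x') y = pure x y + pure x' y.
Proof. by have := pure_linearl y 1 x x'; rewrite !scale1r. Qed.

Lemma tensor_map_comp (M M' M'' : lmodType R) (f : {linear M' -> M''})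
    (g : {linear M -> M'}) (h : {linear M -> M''}) (t : tensor M N) :
  (forall x, f (g x) = h x) -> tensor_map f (tensor_map g t) = tensor_map h t.
Proof.
move=> fg; elim/tensor_ind: t => [|x y t IHt]; first by rewrite !linear0.
by rewrite !linearD /= IHt !tensor_map_pure fg.
Qed.

Lemma tensor_map_add (M M' : lmodType R) (f g h : {linear M -> M'}) (t : tensor M N) :
  (forall x, h x = f x + g x) -> tensor_map h t = tensor_map f t + tensor_map g t.
Proof.
move=> fg; elim/tensor_ind: t => [|x y t IHt]; first by rewrite !linear0 addr0.
by rewrite !linearD /= IHt !tensor_map_pure fg pureDl addrACA.
Qed.

Lemma tensor_map_id (M : lmodType R) (t : tensor M N) :
  tensor_map (idfun : {linear M -> M}) t = t.
Proof.
elim/tensor_ind: t => [|x y t IHt]; first by rewrite linear0.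
by rewrite linearD /= IHt tensor_map_pure.
Qed.

End TensorFacts.

Lemma Tor_zero_resolution (R : comNzRingType) (M N : lmodType R)
    (Q : proj_resolution M) n : Tor_zero n.+1 M N ->
  @homology_zero R (fun i => tensor (Q i) N)
      (fun i => tensor_map (res_diff Q i) (N := N)) n.+1.
Proof.
case=> P HP z z0; have [f [g [h [fd gd gf]]]] := homotopy_equivalence P Q.
have [|w wE] := HP (tensor_map (f n.+1) z).
  rewrite /= (tensor_map_comp (h := f n \o res_diff Q n)); last exact: fd.
  by rewrite -(tensor_map_comp (f := f n) (g := res_diff Q n)) // z0 linear0.
exists (tensor_map (g n.+2) w - tensor_map (h n.+1) z).
rewrite /= linearB /= (tensor_map_comp (h := g n.+1 \o res_diff P n.+1)); last exact: gd.
rewrite -(tensor_map_comp (f := g n.+1) (g := res_diff P n.+1)) // wE.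
rewrite (tensor_map_comp (h := g n.+1 \o f n.+1)) //.
rewrite (tensor_map_add (f := idfun)
  (g := (res_diff Q n.+1 \o h n.+1) \+ (h n \o res_diff Q n))); last exact: gf.
rewrite tensor_map_id (tensor_map_add (f := res_diff Q n.+1 \o h n.+1)
  (g := h n \o res_diff Q n)) //.
rewrite -(tensor_map_comp (f := h n) (g := res_diff Q n) (h := h n \o res_diff Q n)) //.
by rewrite z0 linear0 addr0 -(tensor_map_comp (f := res_diff Q n.+1) (g := h n.+1)
  (h := res_diff Q n.+1 \o h n.+1)) // addrK.
Qed.

Lemma Ext_zero_resolution (R : comNzRingType) (M N : lmodType R)
    (Q : proj_resolution M) n : Ext_zero n.+1 M N ->
  forall v : {linear Q n.+1 -> N}, (forall x, v (res_diff Q n.+1 x) = 0) ->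
  exists u : {linear Q n -> N}, forall x, v x = u (res_diff Q n x).
Proof.
case=> P HP v v0; have [f [g [h [fd gd gf]]]] := homotopy_equivalence P Q.
have [|w wE] := HP (v \o g n.+1 : {linear _ -> _}).
  by apply: hom_eq => x /=; rewrite -gd v0.
have {}wE x : (w : {linear _ -> _}) (res_diff P n x) = v (g n.+1 x).
  by have := congr1 (fun u : Defs.hom _ _ => (u : {linear _ -> _}) x) wE.
exists (((w : {linear _ -> _}) \o f n) \- (v \o h n)) => x /=.
by rewrite -fd wE gf !linearD /= v0 add0r addrK.
Qed.

(** * Tor and Ext through matrices *)

Section FreeModules.
Variable R : comNzRingType.

Lemma row_comb_linear (V : lmodType R) n (v : 'I_n -> V) :
  linear (fun x : 'rV[R]_n => \sum_i x 0 i *: v i).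
Proof.
move=> c x y; rewrite scaler_sumr -big_split; apply: eq_bigr => i _ /=.
by rewrite !mxE scalerDl scalerA.
Qed.

Definition row_comb (V : lmodType R) n (v : 'I_n -> V) : {linear 'rV[R]_n -> V} :=
  pack_linear (row_comb_linear v).

Lemma row_combE (V : lmodType R) n (f : {linear 'rV[R]_n -> V}) x :
  f x = \sum_i x 0 i *: f (delta_mx 0 i).
Proof.
rewrite {1}[x]row_sum_delta linear_sum; apply: eq_bigr => i _.
by rewrite linearZ.
Qed.

Lemma row_comb_delta (V : lmodType R) n (v : 'I_n -> V) i :
  row_comb v (delta_mx 0 i) = v i.
Proof.
rewrite /= (bigD1 i) //= mxE !eqxx scale1r big1 ?addr0 // => j /negPf ji.
by rewrite mxE ji andbF scale0r.
Qed.

Lemma projective_row n : projective ('rV[R]_n : lmodType R).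
Proof.
move=> A B f g /= fonto; have /choice[a aP] i := fonto (g (delta_mx 0 i)).
exists (row_comb a) => x; rewrite linear_sum [RHS]row_combE.
by apply: eq_bigr => i _; rewrite linearZ /= aP.
Qed.

Lemma mulmxr_linear p q (A : 'M[R]_(p, q)) : linear (fun x : 'rV_p => x *m A).
Proof. by move=> c u v; rewrite mulmxDl scalemxAl. Qed.

Definition rowmul p q (A : 'M[R]_(p, q)) : {linear 'rV[R]_p -> 'rV[R]_q} :=
  pack_linear (mulmxr_linear A).

Definition row_exact (D : fcomplex R) : Prop :=
  forall i (x : 'rV_(rk D i.+1)), x *m df D i = 0 -> exists y, x = y *m df D i.+1.

Definition resolves (M : lmodType R) (D : fcomplex R)
    (e : {linear 'rV[R]_(rk D 0) -> M}) : Prop :=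
  [/\ onto e, forall x, e x = 0 <-> exists y, x = y *m df D 0 & row_exact D].

Section FreeResolution.
Variables (M : lmodType R) (D : fcomplex R) (e : {linear 'rV[R]_(rk D 0) -> M}).
Hypothesis resD : resolves e.

Lemma free_exact0 x : e x = 0 <-> exists y, rowmul (df D 0) y = x.
Proof.
case: resD => _ kere _; rewrite kere.
by split=> [[y ->]|[y <-]]; exists y.
Qed.

Lemma free_exactS n x :
  rowmul (df D n) x = 0 <-> exists y, rowmul (df D n.+1) y = x.
Proof.
case: resD => _ _ exD; split=> [/exD[y ->]|[y <-]]; first by exists y.
by rewrite /= -mulmxA df_df mulmx0.
Qed.

Definition free_resolution : proj_resolution M :=
  @ProjResolution R M (fun n => 'rV[R]_(rk D n)) (fun n => rowmul (df D n)) e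
    (fun n => @projective_row (rk D n)) (let: And3 ontoe _ _ := resD in ontoe)
    free_exact0 free_exactS.

End FreeResolution.

Lemma resolves_pd_le (M : lmodType R) (D : fcomplex R) e n :
  @resolves M D e -> (forall i, (n < i)%N -> rk D i = 0%N) -> pd_le M n.
Proof.
move=> resD rk0; exists (free_resolution resD) => i /rk0 ri /= x.
by apply/rowP => -[j lj]; exfalso; rewrite ri in lj.
Qed.

Section TensorFree.
Variable X : lmodType R.

(** The isomorphism from X^n to R^n tensor X, which turns Tor into a condition on families in X. *)
Definition tvec n (z : 'I_n -> X) : tensor ('rV[R]_n : lmodType R) X :=
  \sum_j pure (delta_mx 0 j) (z j).

Definition purel (M : lmodType R) (y : X) : {linear M -> tensor M X} :=
  pack_linear (pure_linearl y).
Definition purer (M : lmodType R) (x : M) : {linear X -> tensor M X} :=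
  pack_linear (pure_linearr x).

Lemma pure_scale (M : lmodType R) (c : R) (x : M) (y : X) :
  pure (c *: x) y = pure x (c *: y).
Proof. by rewrite [LHS](linearZ_LR (purel M y)) [RHS](linearZ_LR (purer x)). Qed.

Lemma pure_rowl n (x : 'rV[R]_n) (y : X) : pure x y = tvec (fun j => x 0 j *: y).
Proof.
rewrite [x in pure x _]row_sum_delta [LHS](linear_sum (purel _ y)).
by apply: eq_bigr => j _; exact: pure_scale.
Qed.

Lemma tvecD n (z z' : 'I_n -> X) : tvec (fun j => z j + z' j) = tvec z + tvec z'.
Proof.
rewrite /tvec -big_split; apply: eq_bigr => j _.
exact: (linearD (purer (delta_mx 0 j : 'rV[R]_n))).
Qed.

Lemma tvec_surj n (t : tensor ('rV[R]_n : lmodType R) X) : exists z, t = tvec z.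
Proof.
elim/tensor_ind: t => [|x y t [z ->]].
  exists (fun=> 0); rewrite /tvec big1 // => j _.
  exact: (linear0 (purer (delta_mx 0 j : 'rV[R]_n))).
by exists (fun j => x 0 j *: y + z j); rewrite tvecD -pure_rowl.
Qed.

Lemma tvec_inj n (z z' : 'I_n -> X) : tvec z = tvec z' -> forall j, z j = z' j.
Proof.
move=> zz' j.
have [|y|f [fE _]] := @tensor_universal R ('rV[R]_n : lmodType R) X X
    (fun x y => x 0 j *: y).
- by move=> y c u v; rewrite !mxE scalerDl scalerA.
- by move=> c u v; rewrite scalerDr scalerA mulrC -scalerA.
have fz w : (f : {linear _ -> _}) (tvec w) = w j.
  rewrite linear_sum (bigD1 j) //= fE mxE !eqxx scale1r big1 ?addr0 // => i ij.
  by rewrite fE mxE eq_sym (negPf ij) scale0r.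
by rewrite -fz zz' fz.
Qed.

Lemma tensor_map_tvec p q (A : 'M[R]_(p, q)) (z : 'I_p -> X) :
  tensor_map (rowmul A) (tvec z) = tvec (fun j => \sum_i A i j *: z i).
Proof.
rewrite linear_sum /= /tvec.
under eq_bigr do rewrite tensor_map_pure /= -rowE pure_rowl.
rewrite exchange_big /=; apply: eq_bigr => j _.
rewrite [RHS](linear_sum (purer (delta_mx 0 j : 'rV[R]_q))).
by apply: eq_bigr => i _; rewrite mxE.
Qed.

Lemma homology_tvec (D : fcomplex R) n :
  @homology_zero R (fun i => tensor ('rV[R]_(rk D i) : lmodType R) X)
    (fun i => tensor_map (rowmul (df D i)) (N := X)) n.+1 <->
  forall z : 'I_(rk D n.+1) -> X, (forall j, \sum_i df D n i j *: z i = 0) ->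
    exists w : 'I_(rk D n.+2) -> X, forall j, z j = \sum_i df D n.+1 i j *: w i.
Proof.
have tvec0 q : tvec (fun=> 0 : X) = 0 :> tensor ('rV[R]_q : lmodType R) X.
  by rewrite /tvec big1 // => j _; exact: (linear0 (purer (delta_mx 0 j : 'rV[R]_q))).
split=> [H z z0|H x /=].
  have [|y] := H (tvec z).
    rewrite /= tensor_map_tvec -[RHS]tvec0; congr tvec; apply: funext => j.
    exact: z0.
  have [w ->] := tvec_surj y; rewrite /= tensor_map_tvec => /tvec_inj wz.
  by exists w => j; rewrite wz.
have [z ->] := tvec_surj x; rewrite tensor_map_tvec -(tvec0 (rk D n)).
move=> /tvec_inj/H[w zw].
exists (tvec w); rewrite tensor_map_tvec; congr tvec; apply: funext => j.
by rewrite zw.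
Qed.

End TensorFree.


Lemma mxin0P p q (A : 'M[R]_(p, q)) : mxin (ideal_gen [::]) A <-> A = 0.
Proof.
split=> [A0|-> i j]; last by rewrite mxE; exact: (submod0 (ideal_genP (@nil R))).
by apply/matrixP => i j; rewrite mxE; exact: ideal_gen_nil.
Qed.

Lemma rows_choice p q r (A : 'M[R]_(p, q)) (B : 'M[R]_(r, q)) :
  (forall i, exists y, row i A = y *m B) -> exists Y, A = Y *m B.
Proof.
move=> /choice[y yP]; exists (\matrix_i y i).
by apply/row_matrixP => i; rewrite row_mul rowK.
Qed.

Lemma row_exact_mod (D : fcomplex R) i : 
  (forall x : 'rV_(rk D i.+1), x *m df D i = 0 -> exists y, x = y *m df D i.+1) ->
  exact_mod (ideal_gen [::]) D i.
Proof.
move=> exD p x /mxin0P x0.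
have [k|y ->] := @rows_choice _ _ _ x (df D i.+1); last first.
  by exists y; apply/mxin0P; rewrite subrr.
by apply: exD; rewrite -row_mul x0 row0.
Qed.

Section TorFree.
Variables (N X : lmodType R) (D E : fcomplex R).
Variables (e : {linear 'rV[R]_(rk D 0) -> N}) (p : {linear 'rV[R]_(rk E 0) -> X}).
Hypotheses (resD : resolves e) (ontop : onto p).
Hypothesis kerp : forall x, p x = 0 <-> exists y, x = y *m df E 0.

(** Families in X are lifted along [p] to matrices. Lifts of the same family differ by a matrix with
    rows in the row space of [df E 0], whence the terms in [v] and [v'] of [tor_mod]. *)
Lemma tor_modP n :
  tor_mod (ideal_gen [::]) D E n 0 <-> Tor_zero n.+1 N X.
Proof.
have psum q r (A : 'M[R]_(q, r)) (W : 'M_(r, rk E 0)) i :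
    p (row i (A *m W)) = \sum_k A i k *: p (row k W).
  rewrite row_mul mulmx_sum_row linear_sum; apply: eq_bigr => k _.
  by rewrite linearZ /= mxE.
split=> [tor|Tor].
  exists (free_resolution resD); apply/homology_tvec => z z0.
  have /choice[w wz] i := ontop (z i); pose W := \matrix_i w i.
  have [i|v vE] := @rows_choice _ _ _ ((df D n)^T *m W) (df E 0).
    apply/kerp; rewrite psum -[RHS](z0 i); apply: eq_bigr => k _.
    by rewrite mxE rowK wz.
  have [|w' [v' /mxin0P/eqP]] := tor W v; first by apply/mxin0P; rewrite vE subrr.
  rewrite subr_eq0 subr_eq addrC => /eqP WE; exists (fun i => p (row i w')) => j.
  have pv : p (row j (v' *m df E 0)) = 0 by apply/kerp; eexists; exact: row_mul.
  rewrite -wz -[w j](rowK w) -/W WE linearD /= linearD /= pv addr0 psum.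
  by apply: eq_bigr => k _; rewrite mxE.
move=> w v /mxin0P/eqP; rewrite subr_eq0 => /eqP wv.
have H := (homology_tvec _ _ _).1 (Tor_zero_resolution (Q := free_resolution resD) Tor).
have [j|u uE] := H (fun i => p (row i w)).
  have : p (row j ((df D n)^T *m w)) = 0.
    by rewrite wv; apply/kerp; eexists; exact: row_mul.
  by rewrite psum => E0; rewrite -[RHS]E0; apply: eq_bigr => k _; rewrite mxE.
have /choice[w' wu] i := ontop (u i); pose W := \matrix_i w' i.
have [i|v' v'E] := @rows_choice _ _ _ (w - (df D n.+1)^T *m W) (df E 0).
  apply/kerp; rewrite linearB /= linearB /= uE psum; apply/eqP; rewrite subr_eq0.
  by apply/eqP; apply: eq_bigr => k _; rewrite mxE rowK wu.
by exists W, v'; apply/mxin0P; rewrite v'E subrr.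
Qed.

End TorFree.

Lemma Ext_zero_free (M N : lmodType R) (D : fcomplex R) e :
  @resolves M D e -> Ext_zero 1 M N ->
  forall v : 'I_(rk D 1) -> N, (forall i, \sum_j df D 1 i j *: v j = 0) ->
  exists u : 'I_(rk D 0) -> N, forall i, v i = \sum_j df D 0 i j *: u j.
Proof.
move=> resD /(Ext_zero_resolution (Q := free_resolution resD)) ext v v0.
have combE n q (A : 'M[R]_(n, q)) (y : 'I_q -> N) (x : 'rV_n) :
    row_comb y (x *m A) = \sum_i x 0 i *: \sum_j A i j *: y j.
  rewrite mulmx_sum_row linear_sum; apply: eq_bigr => i _.
  by rewrite linearZ /=; under eq_bigr do rewrite mxE.
have [x|u uE] := ext (row_comb v).
  by rewrite /= [LHS]combE big1 // => i _; rewrite v0 scaler0.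
exists (fun j => u (delta_mx 0 j)) => i.
rewrite -[LHS](row_comb_delta v) uE /= -rowE [LHS]row_combE.
by apply: eq_bigr => j _; rewrite mxE.
Qed.

End FreeModules.

(** * The cokernel of a matrix as a module *)

Section Cokernel.
Variables (R : comNzRingType) (p q : nat) (A : 'M[R]_(p, q)).

Definition row_space : {pred 'rV[R]_q} := fun x => `[< exists y, x = y *m A >].

Lemma row_space_closed : submod_closed row_space.
Proof.
split=> [|c u v /asboolP[x ->] /asboolP[y ->]]; apply/asboolP.
  by exists 0; rewrite mul0mx.
by exists (c *: x + y); rewrite mulmxDl scalemxAl.
Qed.

HB.instance Definition _ :=
  GRing.isSubmodClosed.Build R 'rV[R]_q row_space row_space_closed.

Definition coker : Type := @Quotient.quot _ row_space.
HB.instance Definition _ := GRing.Zmodule.on coker.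

Definition coker_pi (x : 'rV[R]_q) : coker := \pi_(@Quotient.quot _ row_space) x.

Lemma coker_piP x y : coker_pi x = coker_pi y <-> exists z, x - y = z *m A.
Proof.
split=> [/eqP|[z E]].
  by rewrite -[_ == _]Quotient.idealrBE => /asboolP.
by apply/eqP; rewrite -[_ == _]Quotient.idealrBE; apply/asboolP; exists z.
Qed.

Lemma coker_repr x : coker_pi (repr x) = x.
Proof. exact: reprK. Qed.

Lemma coker_piD x y : coker_pi (x + y) = coker_pi x + coker_pi y.
Proof. exact: Quotient.pi_add. Qed.

Definition coker_scale (c : R) (x : coker) : coker := coker_pi (c *: repr x).

Lemma coker_scaleE c x : coker_scale c (coker_pi x) = coker_pi (c *: x).
Proof.
apply/coker_piP; have /coker_piP[z zE] := coker_repr (coker_pi x).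
by exists (c *: z); rewrite -scalerBr zE scalemxAl.
Qed.

Lemma coker_scaleA a b x : coker_scale a (coker_scale b x) = coker_scale (a * b) x.
Proof. by rewrite -(coker_repr x) !coker_scaleE scalerA. Qed.
Lemma coker_scale1 : left_id 1 coker_scale.
Proof. by move=> x; rewrite -(coker_repr x) !coker_scaleE scale1r. Qed.
Lemma coker_scaleDr : right_distributive coker_scale +%R.
Proof.
move=> c x y; rewrite -(coker_repr x) -(coker_repr y).
by rewrite -coker_piD !coker_scaleE scalerDr coker_piD.
Qed.
Lemma coker_scaleDl x : {morph coker_scale^~ x : a b / a + b}.
Proof.
by move=> a b; rewrite -(coker_repr x) !coker_scaleE scalerDl coker_piD.
Qed.

HB.instance Definition _ := GRing.Zmodule_isLmodule.Build R coker
  coker_scaleA coker_scale1 coker_scaleDr coker_scaleDl.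

Lemma coker_pi_linear : linear coker_pi.
Proof. by move=> c x y; rewrite coker_piD -coker_scaleE. Qed.

Definition coker_proj : {linear 'rV[R]_q -> coker} := pack_linear coker_pi_linear.

Lemma coker_proj_onto : onto coker_proj.
Proof. by move=> x; exists (repr x); exact: coker_repr. Qed.

Lemma coker_proj_ker x : coker_proj x = 0 <-> exists y, x = y *m A.
Proof.
rewrite -(linear0 coker_proj) /=; split=> [/coker_piP[y]|[y ->]].
  by rewrite subr0 => ->; exists y.
by apply/coker_piP; exists y; rewrite subr0.
Qed.

Lemma coker_fg : fg_module coker.
Proof.
exists q, (fun i => coker_proj (delta_mx 0 i)) => x.
by exists (repr x 0); rewrite -[LHS]coker_repr; exact: (row_combE coker_proj).
Qed.

End Cokernel.

(** * Minimal free resolutions *)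

Section Build.
Variables (R : comNzRingType).
Variable next : forall p q : nat, 'M[R]_(p, q) -> {s : nat & 'M[R]_(s, p)}.
Hypothesis next0 : forall p q (A : 'M_(p, q)), projT2 (next A) *m A = 0.
Variables (p q : nat) (A : 'M[R]_(p, q)).

(** The state carries both sizes of the current matrix, since the size of the next one is known only
    once [next] has produced it. *)
Fixpoint build_state (n : nat) : {n0 : nat & {n1 : nat & 'M[R]_(n1, n0)}} :=
  if n is n'.+1 then
    existT (fun n0 : nat => {n1 : nat & 'M[R]_(n1, n0)})
      (projT1 (projT2 (build_state n'))) (next (projT2 (projT2 (build_state n'))))
  else existT _ q (existT _ p A).

Definition build : fcomplex R :=
  @FComplex R (fun n => projT1 (build_state n))
    (fun n => projT2 (projT2 (build_state n))) (fun n => next0 _).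

End Build.

Section Prepend.
Variables (R : comNzRingType) (D : fcomplex R) (q : nat) (A : 'M[R]_(rk D 0, q)).
Hypothesis dfA : df D 0 *m A = 0.

Let prk n := if n is n'.+1 then rk D n' else q.
Let pdf n : 'M[R]_(prk n.+1, prk n) :=
  match n return 'M[R]_(prk n.+1, prk n) with 0%N => A | n'.+1 => df D n' end.

Lemma prepend_df_df n : pdf n.+1 *m pdf n = 0.
Proof. by case: n => [|n] /=; [exact: dfA | exact: df_df]. Qed.

Definition prepend : fcomplex R := FComplex prepend_df_df.

End Prepend.

Section LocalResolutions.
Variable R : comNzRingType.
Hypothesis localR : local_ring R.

Local Notation m := (@nonunit R).
Let idm : ideal m := local_nonunit localR.
Let noethR : noetherian R := let: conj h _ := localR in h.

Lemma min_kernel p q (A : 'M[R]_(p, q)) : exists B : {s : nat & 'M[R]_(s, p)},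
  (forall x : 'rV_p, x *m A = 0 <-> exists c, x = c *m projT2 B) /\
  (forall c : 'rV_(projT1 B), c *m projT2 B = 0 -> mxin m c).
Proof.
have [|s [G [GA minG]]] := minimal_rows noethR (@nonunit_unit R) (K := fun x => x *m A = 0).
  split=> [|c u v uA vA]; first by rewrite mul0mx.
  by rewrite mulmxDl -scalemxAl uA vA scaler0 addr0.
by exists (existT _ s G).
Qed.

Lemma minimal_build p q (A : 'M[R]_(p, q)) : exists next next0,
  let D := @build R next next0 p q A in row_exact D /\
    forall n (c : 'rV_(rk D n.+2)), c *m df D n.+1 = 0 -> mxin m c.
Proof.
pose next p' q' (B : 'M_(p', q')) := sval (cid (min_kernel B)).
have nextP p' q' (B : 'M_(p', q')) := svalP (cid (min_kernel B)).
have next0 p' q' (B : 'M_(p', q')) : projT2 (next _ _ B) *m B = 0.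
  apply/row_matrixP => i; rewrite row_mul row0; apply/(nextP _ _ B).1.
  by exists (delta_mx 0 i); rewrite -rowE.
exists next, next0; split=> [n x|n c]; first by move/(nextP _ _ _).1.
exact: (nextP _ _ _).2.
Qed.

Lemma minimal_df_in (D : fcomplex R) n :
  (forall c : 'rV_(rk D n.+1), c *m df D n = 0 -> mxin m c) -> mxin m (df D n.+1).
Proof.
move=> minD i j; have := minD (row i (df D n.+1)).
by rewrite -row_mul df_df row0 => /(_ erefl 0 j); rewrite mxE.
Qed.

Lemma minimal_resolution (M : lmodType R) : fg_module M ->
  exists (D : fcomplex R) (e : {linear 'rV[R]_(rk D 0) -> M}),
  [/\ resolves e, forall n (c : 'rV_(rk D n.+1)), c *m df D n = 0 -> mxin m c &
      mxin m (df D 0)].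
Proof.
case=> n [g genM].
have sub0 : submodule (fun x : M => x = 0).
  by split=> // c u v -> ->; rewrite scaler0 addr0.
have [|s [h [[_ genh] minh]]] := generates_min (@nonunit_unit R) sub0
    (K := fun=> True) (g := g).
  by split=> // x _; have [c ->] := genM x; exists c; rewrite subrr.
pose e := row_comb h.
have [|p [A [keA minA]]] := minimal_rows noethR (@nonunit_unit R) (K := fun x => e x = 0).
  by split=> [|c u v eu ev]; [exact: linear0 | rewrite linearP eu ev scaler0 addr0].
have [next [next0 [exD minD]]] := minimal_build A.
exists (build next0 A), e; split=> [|[|k]|] //; first split=> //.
- move=> x; have [c /eqP] := genh x I; rewrite subr_eq0 => /eqP ->.
  exists (\row_i c i) => /=.
  by apply: eq_bigr => i _; rewrite mxE.
- exact: minD.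
- move=> i j /=; have /minh/(_ j) : \sum_j A i j *: h j = 0; last exact.
  have /keA : exists c, row i A = c *m A by exists (delta_mx 0 i); rewrite -rowE.
  by move=> /= E; rewrite -[RHS]E; apply: eq_bigr => l _; rewrite mxE.
Qed.

Lemma minimal_rk0 (D : fcomplex R) n :
  (forall c : 'rV_(rk D n.+1), c *m df D n = 0 -> mxin m c) ->
  rk D n = 0%N -> rk D n.+1 = 0%N.
Proof.
move=> minD rk0; apply/eqP; rewrite -leqn0 leqNgt; apply/negP => rk_gt0.
have /minD/(_ 0 (Ordinal rk_gt0)) : (delta_mx 0 (Ordinal rk_gt0) : 'rV_(rk D n.+1)) *m df D n = 0.
  by apply/rowP => -[j lj]; exfalso; rewrite rk0 in lj.
by rewrite mxE !eqxx => /nonunit1.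
Qed.

End LocalResolutions.

(** * The dual of M *)

Lemma ker_submodule (R : comNzRingType) p q (A : 'M[R]_(p, q)) :
  submodule (fun y : 'rV_p => y *m A = 0).
Proof.
split=> [|c u v uA vA]; first by rewrite mul0mx.
by rewrite mulmxDl -scalemxAl uA vA scaler0 addr0.
Qed.

Section ExtTor.
Variables (R : comNzRingType) (M N : lmodType R) (C D : fcomplex R).
Variables (eM : {linear 'rV[R]_(rk C 0) -> M}) (eN : {linear 'rV[R]_(rk D 0) -> N}).
Hypotheses (resC : resolves eM) (resD : resolves eN).
Hypothesis Ext1 : Ext_zero 1 M N.

(** The columns of [v] represent a cocycle from F_1 to N. It is a coboundary, lifted to [v']; the
    ambiguity of lifting from N to a free module is the term in [w']. *)
Lemma Ext1_matrix (v : 'M_(rk D 0, rk C 1)) w : v *m (df C 1)^T = (df D 0)^T *m w ->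
  exists v' w', v = v' *m (df C 0)^T + (df D 0)^T *m w'.
Proof.
have [ontoN kerN _] := resD; move=> vw.
have esum q r (A : 'M[R]_(q, r)) (W : 'M_(r, rk D 0)) i :
    eN (row i (A *m W)) = \sum_k A i k *: eN (row k W).
  rewrite row_mul mulmx_sum_row linear_sum; apply: eq_bigr => k _.
  by rewrite linearZ /= mxE.
have [i|u uE] := Ext_zero_free resC Ext1 (v := fun j => eN (row j v^T)).
  rewrite -esum -[df C 1]trmxK -trmx_mul vw trmx_mul trmxK; apply/kerN.
  by eexists; exact: row_mul.
have /choice[u' uu'] i := ontoN (u i); pose U := \matrix_i u' i.
have [i|W WE] := @rows_choice _ _ _ _ (v^T - df C 0 *m U) (df D 0).
  apply/kerN; rewrite !linearB /= uE esum; apply/eqP; rewrite subr_eq0; apply/eqP.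
  by apply: eq_bigr => j _; rewrite rowK uu'.
exists U^T, W^T; rewrite -!trmx_mul -linearD /= -[LHS]trmxK; congr trmx.
by rewrite -WE addrC subrK.
Qed.

Lemma dfCT : (df C 0)^T *m (df C 1)^T = 0.
Proof. by rewrite -trmx_mul df_df trmx0. Qed.

Variable next : forall p q : nat, 'M[R]_(p, q) -> {s : nat & 'M[R]_(s, p)}.
Hypothesis next0 : forall p q (A : 'M_(p, q)), projT2 (next A) *m A = 0.

(* The dual presentation F_0^* -> F_1^* -> F_2^* of M, continued to the left by
   kernels; at F_1^* it is exact if and only if Ext^1(M, R) = 0. *)
Definition dual_complex : fcomplex R :=
  @prepend R (build next0 (df C 0)^T) _ (df C 1)^T dfCT.

Local Notation E := dual_complex.

(** [Ext1_matrix] splits [v] into a part killed by [df E 0] and a part in [w']. So the transpose of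
    [df D 0] kills w - w' E_0, and exactness of [D] applies. *)
Lemma Ext1_tor : tor_mod (ideal_gen [::]) D E 0 0.
Proof.
move=> w v /mxin0P/eqP; rewrite subr_eq0 => /eqP wv.
have [v' [w' vE]] := Ext1_matrix (esym wv).
have [_ _ exD] := resD.
have [|y /mxin0P yE] := exact_mod_tr (row_exact_mod (exD 0%N)) (x := w - w' *m df E 0).
  apply/mxin0P; rewrite mulmxBr wv /= vE mulmxDl -[v' *m _ *m _]mulmxA dfCT.
  by rewrite mulmx0 add0r mulmxA subrr.
exists y, w'; apply/mxin0P; rewrite -[RHS]yE.
by rewrite addrAC.
Qed.

Hypothesis N_rigid : Tor_rigid N.

Lemma rigid_tor n : tor_mod (ideal_gen [::]) D E n 0.
Proof.
have TorP i := tor_modP resD (@coker_proj_onto _ _ _ (df E 0))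
  (@coker_proj_ker _ _ _ (df E 0)) i.
apply/TorP; elim: n => [|n IHn]; first exact/TorP/Ext1_tor.
by apply: N_rigid => //; exact: coker_fg.
Qed.

Hypothesis localR : local_ring R.
Hypothesis minD0 : mxin (@nonunit R) (df D 0).
Hypothesis D0 : (0 < rk D 0)%N.

(** This is Ext^1(M, R) = 0. By Nakayama it suffices that each cycle is a boundary up to m times
    cycles. *)
Lemma dual_exact0 (y : 'rV_(rk E 1)) : y *m df E 0 = 0 -> exists z, y = z *m df E 1.
Proof.
have [noethR _] := localR; have [_ _ exD] := resD.
have idz := ideal_genP (@nil R).
move: y; apply: (row_nakayama noethR (local_nonunit localR) (@nonunit1 R)
  (@nonunit_unit R) (ker_submodule (df E 0)) (B := fun y => exists z, y = z *m df E 1)).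
  split=> [|c u v [y ->] [z ->]]; first by exists 0; rewrite mul0mx.
  by exists (c *: y + z); rewrite mulmxDl -scalemxAl.
move=> y yE; pose i0 := Ordinal D0.
(* The cycle [y] is put in row [i0] of a matrix that is zero elsewhere, that is, tensored with one
   generator of N. *)
have [|v' [w vE]] := @Ext1_matrix (delta_mx i0 0 *m y) 0.
  by rewrite mulmx0 -mulmxA [y *m _]yE mulmx0.
have [|u /mxin0P/eqP] := exact_mod_tr (row_exact_mod (exD 0%N)) (x := w *m df E 0).
  apply/mxin0P; have := congr1 (mulmx^~ (df E 0)) vE.
  rewrite mulmxDl -[v' *m _ *m _]mulmxA [_^T *m df E 0]dfCT mulmx0 add0r -mulmxA.
  by rewrite yE mulmx0 mulmxA => <-.
rewrite subr_eq0 => /eqP wu.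
(* Index 1 is the vanishing of Tor_2. It corrects [w] to [w3], whose rows are cycles, without
   changing its product with the transpose of [df D 0]. *)
have [|a [b /mxin0P/eqP]] := @rigid_tor 1 u w; first by apply/mxin0P; rewrite wu subrr.
rewrite -addrA -opprD subr_eq0 => /eqP uab.
pose w3 := w - (df D 1)^T *m b.
have w3E : w3 *m df E 0 = 0.
  rewrite mulmxBl wu uab mulmxDr !mulmxA -trmx_mul df_df trmx0 mul0mx add0r.
  by rewrite subrr.
have {}vE : delta_mx i0 0 *m y = v' *m (df C 0)^T + (df D 0)^T *m w3.
  by rewrite vE /w3 mulmxBr [X in _ - X]mulmxA -trmx_mul df_df trmx0 mul0mx subr0.
(* Row [i0] of the identity is a boundary plus a combination of rows of [w3], with coefficients from
   [df D 0], which lie in m. *)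
exists _, (fun k => df D 0 k i0), (fun k => row k w3); split.
- by move=> k; exact: minD0.
- by move=> k; rewrite -row_mul w3E row0.
exists (row i0 v').
have yi0 : y = row i0 (delta_mx i0 0 *m y).
  rewrite row_mul (_ : row i0 _ = 1%:M) ?mul1mx //.
  by apply/matrixP => i j; rewrite (ord1 i) (ord1 j) !mxE !eqxx.
rewrite {1}yi0 vE linearD /= row_mul [X in _ + X - _](_ : _ = \sum_k df D 0 k i0 *: row k w3).
  by rewrite addrK.
rewrite row_mul mulmx_sum_row; apply: eq_bigr => k _.
by rewrite !mxE.
Qed.

Hypothesis exF : row_exact (build next0 (df C 0)^T).

Lemma dual_exact : row_exact E.
Proof. by case=> [|i]; [exact: dual_exact0 | exact: exF]. Qed.

Lemma dual_tor i j : tor_mod (ideal_gen [::]) D E i j.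
Proof.
have idz := ideal_genP (@nil R); have [_ _ exD] := resD.
elim: j i => [|j IHj] i; first exact: rigid_tor.
apply: tor_mod_shift => //; apply: row_exact_mod; [exact: exD | exact: dual_exact].
Qed.

End ExtTor.

(** A row killed by the transpose of [df C 0] vanishes on the relations of M, so pairing with it is
    a functional on M, and all functionals arise so. As [G] is injective, its rows are a basis. *)
Lemma dual_free (R : comNzRingType) (M : lmodType R) (C : fcomplex R)
    (e : {linear 'rV[R]_(rk C 0) -> M}) n (G : 'M_(n, rk C 0)) :
  resolves e ->
  (forall y : 'rV_(rk C 0), y *m (df C 0)^T = 0 <-> exists z, y = z *m G) ->
  (forall z : 'rV_n, z *m G = 0 -> z = 0) -> free_module (dual M).
Proof.
case=> ontoe kere _ GP injG.
have /choice[s sP] := ontoe.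
have GC (z : 'rV_n) : z *m G *m (df C 0)^T = 0 by apply/GP; exists z.
have eG y (z : 'rV_n) : e y = 0 -> y *m (z *m G)^T = 0.
  move=> /kere[x ->]; rewrite -mulmxA -[df C 0]trmxK -trmx_mul GC.
  by rewrite trmx0 mulmx0.
pose f0 (z : 'rV_n) (x : M) : R^o := (s x *m (z *m G)^T) 0 0.
have f0E z y : f0 z (e y) = (y *m (z *m G)^T) 0 0.
  have /(eG _ z) : e (s (e y) - y) = 0 by rewrite linearB /= sP subrr.
  by rewrite mulmxBl => /eqP; rewrite subr_eq0 /f0 => /eqP ->.
have f0_lin z : linear (f0 z).
  move=> c x y; rewrite -[x]sP -[y]sP -linearP !f0E mulmxDl -scalemxAl.
  by rewrite !mxE.
pose f z : dual M := pack_linear (f0_lin z).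
have f_lin : linear f.
  move=> c y z; apply: hom_eq => x; rewrite -[x]sP [LHS]f0E.
  rewrite [RHS](_ : _ = c * f0 y (e (s x)) + f0 z (e (s x))) // !f0E.
  by rewrite mulmxDl -scalemxAl linearP /= mulmxDr -scalemxAr !mxE.
have f_inj z : f z = 0 -> z = 0.
  move=> fz; apply: injG; apply/rowP => i.
  have := congr1 (fun u : dual M => (u : {linear _ -> _}) (e (delta_mx 0 i))) fz.
  by rewrite [LHS]f0E -rowE !mxE.
have f_onto : onto f.
  move=> u; pose y := \row_i (u : {linear _ -> _}) (e (delta_mx 0 i)) : 'rV[R]_(rk C 0).
  have uE x : (u : {linear _ -> _}) (e x) = (x *m y^T) 0 0.
    rewrite [x in LHS]row_sum_delta !linear_sum /= mxE; apply: eq_bigr => i _.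
    by rewrite !linearZ /= !mxE.
  have [|z zE] := (GP y).1.
    apply/rowP => i; rewrite -[_ *m _]trmxK trmx_mul trmxK [RHS]mxE mxE.
    have : e (row i (df C 0)) = 0 by apply/kere; exists (delta_mx 0 i); rewrite -rowE.
    by move=> /(congr1 (fun w => (u : {linear _ -> _}) w)); rewrite uE linear0 -row_mul mxE.
  by exists z; apply: hom_eq => x; rewrite -[x]sP [LHS]f0E -zE uE.
have /choice[g gP] := f_onto.
exists n, (pack_linear f_lin), g => [z|u] /=; last exact: gP.
apply/eqP; rewrite -subr_eq0; apply/eqP/f_inj.
rewrite -[f _]/(pack_linear f_lin _) linearB /= gP.
by rewrite subrr.
Qed.

Lemma quasi_fiber_splits (R : comNzRingType) : quasi_fiber_product_ring R ->
  exists xs, regular_sequence xs /\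
    exists I J, splits (@nonunit R) (ideal_gen xs) I J.
Proof.
case=> localR [xs [a [regxs aP [_ [k [S [T [piS [piT fib]]]]]]]]].
exists xs; split=> //; have -> : ideal_gen xs = (fun x => x \in a).
  by apply: funext => x; apply/propext; split=> /aP.
exact: (fiber_splits localR fib).
Qed.

(* R/(xs) has depth zero, so over it an injective matrix with entries in the
   maximal ideal has no rows. *)
Lemma artinian_rk0 (R : comNzRingType) (xs : seq R) d (E : fcomplex R) i :
  local_ring R -> regular_sequence xs -> krull_dim_le R d -> size xs = d ->
  exact_mod (ideal_gen xs) E i -> mxin (@nonunit R) (df E i) ->
  rk E i.+2 = 0%N -> rk E i.+1 = 0%N.
Proof.
move=> localR regxs dimR sz exE mE rk0.
apply/eqP; rewrite -leqn0 leqNgt; apply/negP => rk_gt0; pose l := Ordinal rk_gt0.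
have ida := ideal_genP xs.
(* [s] kills row [l] modulo the ideal, so [s] times the basis vector [l] is a cycle. As the next
   rank is 0, the only boundary is 0, which would put [s] into the ideal. *)
have [j|s [ns sE]] := nilpotent_socle regxs (f := df E i l).
  exact: (nonunit_nilpotent regxs localR dimR sz (mE l j)).
have [|y ay] := exE _ (s *: delta_mx 0 l : 'rV_(rk E i.+1)).
  by move=> k j; rewrite -scalemxAl -rowE !mxE; exact: sE.
apply: ns; have := ay 0 l.
have -> : y = 0 by apply/rowP => -[j lj]; exfalso; rewrite rk0 in lj.
by rewrite mul0mx subr0 !mxE !eqxx mulr1.
Qed.

Theorem corollary3p14 (R : comNzRingType)
    (hR : quasi_fiber_product_ring R) (hdim : krull_dim_le R 3)
    (M N : lmodType R) (fgM : fg_module M) (fgN : fg_module N)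
    (M_neq0 : exists x : M, x <> 0) (N_neq0 : exists x : N, x <> 0)
    (N_rigid : Tor_rigid N) (Ext1 : Ext_zero 1 M N)
    (pdN : pd_infinite N) :
  free_module (dual M).
Proof.
have [localR _] := hR.
have [xs [regxs [I [J sIJ]]]] := quasi_fiber_splits hR.
have idm := local_nonunit localR; have ida := ideal_genP xs.
have aS : ideal_gen xs = ideal_gen (take (size xs) xs) by rewrite take_size.
have a0 : ideal_gen [::] = ideal_gen (take 0 xs) by rewrite take0.
have am x : ideal_gen xs x -> nonunit x by apply: proper_nonunit => //; case: regxs.
have [C [eM [resC _ _]]] := minimal_resolution localR fgM.
have [D [eN [resD minD mD0]]] := minimal_resolution localR fgN.
have [next [next0 [exF minF]]] := minimal_build localR (df C 0)^T.
pose E := dual_complex C next0.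
have D0 : (0 < rk D 0)%N.
  rewrite lt0n; apply/eqP => rk0; case: N_neq0 => x; apply.
  have [[ontoN _ _] [y <-]] := (resD, let: And3 h _ _ := resD in h x).
  have -> : y = 0 by apply/rowP => -[j lj]; exfalso; rewrite rk0 in lj.
  exact: linear0.
have exE : row_exact E := dual_exact resC resD Ext1 N_rigid localR mD0 D0 exF.
have torDE := dual_tor resC resD Ext1 N_rigid localR mD0 D0 exF.
have [_ _ exD] := resD.
(* Reduction modulo [xs] is controlled from index [size xs] on. Entries in m are ensured for
   [df E i] only above index 2, after the dual presentation and the first kernel. *)
pose q := maxn (size xs) 2.
have sq i : (q <= i)%N -> (size xs <= i)%N by rewrite geq_max => /andP[].
have exDq i : (size xs <= i)%N -> exact_mod (ideal_gen xs) D i.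
  move=> si; rewrite aS; apply: exact_mod_regular => // k; rewrite -a0.
  exact/row_exact_mod/exD.
have exEq i : (size xs <= i)%N -> exact_mod (ideal_gen xs) E i.
  move=> si; rewrite aS; apply: exact_mod_regular => // k; rewrite -a0.
  exact/row_exact_mod/exE.
have mE i : (2 < i)%N -> mxin (@nonunit R) (df E i).
  by case: i => [|[|[|i]]] // _; apply: (minimal_df_in (D := build next0 (df C 0)^T)); exact: minF.
have [|||||rkD|rkE] := core idm ida (@nonunit1 R) (@nonunit_unit R) am
    (D := D) (E := E) (q := q) sIJ.
- by move=> i /sq /exDq.
- by move=> i /sq /exEq.
- by case=> [//|i] _; apply: minimal_df_in; exact: minD.
- by move=> i qi; apply: mE; apply: leq_ltn_trans qi; exact: leq_maxr.
- move=> i j /sq si /sq sj; rewrite aS; apply: tor_mod_regular => // [k|k l].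
    by rewrite -a0; exact/row_exact_mod/exE.
  by rewrite -a0; exact: torDE.
- case: (pdN q.+1); apply: (resolves_pd_le resD) => i.
  elim: i => [//|i IHi]; rewrite ltnS leq_eqVlt => /predU1P[<-//|/IHi rki].
  exact: minimal_rk0 (minD i) rki.
(* For [size xs <= 2], [q.+2] is 4. For [size xs = 3] only rank 5 is known to vanish, and the
   Artinian step lowers this to 4. *)
have rkE4 : rk E 4 = 0%N.
  have := regular_size regxs localR hdim.
  rewrite leq_eqVlt => /predU1P[sz|s2]; last first.
    by move: rkE; rewrite /q (maxn_idPr (s2 : (size xs <= 2)%N)).
  apply: (artinian_rk0 (i := 3) localR regxs hdim sz); first by apply: exEq; rewrite sz.
    exact: mE.
  by move: rkE; rewrite /q sz.
(* As rank 4 is 0, exactness makes [df E 2] injective, with image the kernel of the transpose of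
   [df C 0]. *)
apply: (dual_free (n := rk E 3) (G := df E 2) resC).
  move=> y; split=> [|[z ->]]; first exact: (exE 1%N).
  by rewrite -mulmxA (df_df E 1 : df E 2 *m (df C 0)^T = 0) mulmx0.
move=> z /(exE 2%N)[y ->].
have -> : y = 0 by apply/rowP => -[j lj]; exfalso; rewrite rkE4 in lj.
exact: mul0mx.
Qed.
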